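(* Let $\lambda \in (\frac12, 1)$ be such that $\frac1\lambda$ is a Pisot number, and let $\mathcal S_\lambda = \{\phi_{-1}, \phi_1\}$ be the iterated function system on $\mathbb R$ given by $\phi_{-1}(x) = \lambda x - 1$, $\phi_1(x) = \lambda x + 1$. Then the topological overlap number of $\mathcal S_\lambda$ satisfies $o(\mathcal S_\lambda) \ge 2\lambda > 1$.
   Context: A Pisot number is a real algebraic integer greater than $1$ all of whose other conjugates are strictly less than $1$ in absolute value. Topological overlap number. Let $\mathcal S=\{\phi_i, i\in I\}$ be a finite iterated function system of injective conformal contractions, with limit set $\Lambda$ (the unique nonempty compact set with $\Lambda=\bigcup_{i\in I}\phi_i(\Lambda)$), and write $\phi_{i_1\ldots i_p}=\phi_{i_1}\circ\cdots\circ\phi_{i_p}$. For $\mathcal S_\lambda$, $I=\{-1,1\}$ and $\Lambda=[-\frac1{1-\lambda},\frac1{1-\lambda}]$. Let $\Sigma_I^+=\{\omega=(\omega_1,\omega_2,\ldots):\omega_i\in I\}$ with the shift $\sigma$, and let $\Phi:\Sigma_I^+\times\Lambda\to\Sigma_I^+\times\Lambda$, $\Phi(\omega,x)=(\sigma\omega,\phi_{\omega_1}(x))$, be the lift of $\mathcal S$. Let $\mu_{max}$ be the measure of maximal entropy of $\Phi$ (the equilibrium measure of the zero potential). The topological overlap number $o(\mathcal S)$ is the overlap number of $\mu_{max}$, namely $$o(\mathcal S)=\exp\Big(\lim_{n\to\infty}\frac1n\int_{\Sigma_I^+\times\Lambda}\log \mathrm{Card}\{(\eta_1,\ldots,\eta_n)\in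 I^n:\ \exists y\in\Lambda,\ \phi_{\omega_n\ldots\omega_1}(x)=\phi_{\eta_n\ldots\eta_1}(y)\}\,d\mu_{max}(\omega,x)\Big).$$ It is known that the limit exists and that, equivalently, $o(\mathcal S)=\exp\big(\lim_{n\to\infty}\frac1n\int_{\Sigma_I^+}\log\beta_n(\pi\omega)\,d\mu_{max}^+(\omega)\big)$, where $\beta_n(x)=\mathrm{Card}\{(\eta_1,\ldots,\eta_n)\in I^n: x\in\phi_{\eta_1\ldots\eta_n}(\Lambda)\}$, $\pi:\Sigma_I^+\to\Lambda$, $\pi(\omega)=\phi_{\omega_1\omega_2\ldots}:=\lim_{p\to\infty}\phi_{\omega_1\ldots\omega_p}(z)$ (for any $z\in\Lambda$) is the canonical projection, and $\mu_{max}^+$ is the Bernoulli measure on $\Sigma_I^+$ with weights $(\frac1{|I|},\ldots,\frac1{|I|})$. *)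

(* Defs.v *)
From HB Require Import structures.
From mathcomp Require Import all_boot all_order all_algebra.
From mathcomp Require Import all_classical all_reals all_analysis.
From mathcomp Require Import complex.

Set Implicit Arguments.
Unset Strict Implicit.
Unset Printing Implicit Defensive.

Import Order.TTheory GRing.Theory Num.Theory.
Import numFieldNormedType.Exports.

Local Open Scope classical_set_scope.
Local Open Scope ring_scope.

(* [p] is the minimal polynomial of [theta] over the rationals (it has integer
   coefficients since [theta] is an algebraic integer); its complex roots are
   the conjugates of [theta]. *)
Definition pisot_number (R : realType) (theta : R) : Prop :=
  1 < theta /\
  exists p : {poly int},
    [/\ p \is monic,
        irreducible_poly (map_poly (intr : int -> rat) p),
        root (map_poly (intr : int -> R) p) theta &
        forall z : R[i], root (map_poly (intr : int -> R[i]) p) z ->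
          z != theta%:C%C -> `|z| < 1].

Section MetricEntropy.
Context {R : realType} {d : measure_display} {T : measurableType d}.
Implicit Types (mu : probability T R) (f : T -> T).

(* A finite partition is encoded by its labelling map [xi : T -> J], the atoms
   being the fibres of [xi]; empty fibres contribute [0 * ln 0 = 0]. *)
Definition partition_entropy mu (J : finType) (xi : T -> J) : R :=
  - \sum_(j : J) fine (mu (xi @^-1` [set j])) * ln (fine (mu (xi @^-1` [set j]))).

(* Labelling map of the join of [f^-k xi] for [0 <= k < n]. *)
Definition iterated_partition f (J : finType) (xi : T -> J) (n : nat) :
    T -> {ffun 'I_n -> J} :=
  fun x => [ffun k : 'I_n => xi (iter k f x)].

Definition entropy_wrt mu f (J : finType) (xi : T -> J) : R :=
  limn (fun n => partition_entropy mu (iterated_partition f xi n) / n%:R).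

(* Kolmogorov-Sinai entropy: supremum over finite measurable partitions. *)
Definition metric_entropy mu f : \bar R :=
  ereal_sup [set h : \bar R | exists (k : nat) (xi : T -> 'I_k),
    (forall j, measurable (xi @^-1` [set j])) /\
    h = (entropy_wrt mu f xi)%:E].

Definition invariant_probability mu f : Prop :=
  forall A, measurable A -> mu (f @^-1` A) = mu A.

(* [mu] is a measure of maximal entropy of the restriction of [f] to the
   measurable set [D]; measures on [D] are measures on [T] with [mu D = 1]. *)
Definition max_entropy_measure f (D : set T) mu : Prop :=
  [/\ mu D = 1%E, invariant_probability mu f &
      forall nu : probability T R, nu D = 1%E -> invariant_probability nu f ->
        (metric_entropy nu f <= metric_entropy mu f)%E].

End MetricEntropy.

(* One-sided sequences, with the Borel sigma-algebra of the product topology;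
   the index set {-1, 1} is [bool], [true] standing for 1 and [false] for -1.
   Sequences are indexed from 0, so [w k] is the (k+1)-st symbol. *)
Definition coordinate_sets : set (set (nat -> bool)) :=
  [set A | exists (k : nat) (b : bool), A = [set w | w k = b]].

Notation symbolic_space := (g_sigma_algebraType coordinate_sets).

Section OverlapNumber.
Context {R : realType}.
Implicit Types (phi : bool -> R -> R).

(* [xget] selects the unique invariant nonempty compact set. *)
Definition limit_set phi : set R :=
  xget set0 [set K | [/\ K !=set0, compact K &
                        K = \bigcup_(i in [set: bool]) phi i @` K]].

(* [phi_word phi [:: i_1; ...; i_p]] is [phi i_1 \o ... \o phi i_p]. *)
Definition phi_word phi (s : seq bool) (x : R) : R := foldr phi x s.

Definition lift_map phi (p : symbolic_space * measurableTypeR R) :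
    symbolic_space * measurableTypeR R :=
  ((fun k => p.1 k.+1) : symbolic_space, phi (p.1 0%N) p.2).

Definition lift_domain phi : set (symbolic_space * measurableTypeR R) :=
  [set p | limit_set phi p.2].

(* A measure of maximal entropy of the lift; [point], a Dirac mass, is only the
   default value of [xget] when no such measure exists. *)
Definition mu_max phi : probability (symbolic_space * measurableTypeR R)%type R :=
  xget point [set mu | max_entropy_measure (lift_map phi) (lift_domain phi) mu].

Definition overlap_count phi (n : nat) (w : nat -> bool) (x : R) : nat :=
  #|[pred eta : n.-tuple bool |
      `[< exists2 y, limit_set phi y &
          phi_word phi (rev (mkseq w n)) x = phi_word phi (rev eta) y >]]|.

Definition overlap_number phi
    (mu : probability (symbolic_space * measurableTypeR R)%type R) : R :=
  expR (limn (fun n =>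
    (n%:R)^-1 *
    \int[mu]_(p in lift_domain phi) ln (overlap_count phi n p.1 p.2)%:R)).

Definition topological_overlap_number phi : R := overlap_number phi (mu_max phi).

End OverlapNumber.

Definition S_ifs {R : realType} (lambda : R) (b : bool) (x : R) : R :=
  lambda * x + (if b then 1 else -1).

(* Main.v *)
(** Put V(w) = phi_w(0) for a word w of length n.  If two words v, w
    have V(v) = V(w) then phi_v = phi_w, so at a point produced by w the overlap
    count is at least m(w) = #{v : V(v) = V(w)}; and it is at most the number
    M(w) of words v with |V(v) - V(w)| <= 2 lambda^n / (1 - lambda).

    Since 1/lambda is Pisot, Garsia's lemma separates distinct values of V by at
    least c lambda^n (the norm of a nonzero element of Z[1/lambda] is a nonzero
    integer, and the other conjugates stay bounded).  Hence there are
    O(lambda^-n) values, and the sum of 1/m(w) counts them; by concavity of the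
    logarithm the uniform average a(n) of ln m(w) is at least
    n ln (2 lambda) - O(1), and the uniform average of ln M(w) is at most
    a(n) + O(1).  Concatenation makes a(n) superadditive, so a(n)/n converges by
    Fekete's lemma, to a limit >= ln (2 lambda).

    It remains to see that a measure of maximal entropy of the lift exists and
    that the first n symbols are uniformly distributed under any such measure.
    The fibre maps are increasing, so for a partition of the fibre by thresholds
    the itineraries of length n over a fixed symbol sequence form a chain, hence
    are linearly many in n: such partitions contribute no entropy beyond that of
    the symbols, and neither do arbitrary measurable partitions, which are
    approximated by them.  Bernoulli measure times its stationary distribution
    attains ln 2, and a measure attaining ln 2 has uniform n-symbol marginals by
    subadditivity of entropy. *)

From HB Require Import structures.
Require Import Defs.
From mathcomp Require Import all_boot all_order all_algebra.
From mathcomp Require Import all_classical all_reals all_analysis.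
From mathcomp Require Import measurable_realfun complex ring lra zify.
Import Order.TTheory GRing.Theory Num.Theory.
Import numFieldNormedType.Exports.
Local Open Scope classical_set_scope.
Local Open Scope ring_scope.

Set Implicit Arguments.
Unset Strict Implicit.
Unset Printing Implicit Defensive.

(** * Garsia's separation lemma *)

Lemma horner_char_poly (F : comNzRingType) (n : nat) (A : 'M[F]_n) (w : F) :
  (char_poly A).[w] = \det (w%:M - A).
Proof.
rewrite -[LHS]/(horner_eval w (char_poly A)) /char_poly -det_map_mx.
congr (\det _); apply/matrixP => i j; rewrite !mxE.
by rewrite /= /horner_eval hornerD hornerN hornerC hornerMn hornerX.
Qed.

(* Both sides are the resultant of [char_poly A] and [q]: factor [q] as well and
   exchange the two products. *)
Lemma det_horner_mx (F : closedFieldType) (n : nat) (A : 'M[F]_n.+1)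
    (q : {poly F}) (rs : seq F) :
  char_poly A = \prod_(z <- rs) ('X - z%:P) ->
  \det (horner_mx A q) = \prod_(z <- rs) q.[z].
Proof.
move=> charA.
have size_rs : size rs = n.+1.
  by apply: succn_inj; rewrite -(size_char_poly A) charA size_prod_XsubC.
have [ws qE] := closed_field_poly_normal q.
have const c : \prod_(z <- rs) c = c ^+ n.+1.
  by rewrite big_const_seq count_predT size_rs iter_mulr_1.
rewrite {1}qE linearZ /= detZ rmorph_prod /=.
have -> : \det (\prod_(w <- ws) horner_mx A ('X - w%:P)) =
    \prod_(w <- ws) \prod_(z <- rs) (z - w).
  elim: ws {qE} => [|w ws IH]; first by rewrite !big_nil det1.
  rewrite !big_cons -[RHS]/(_ * _) -IH.
  rewrite -[_ * \prod_(_ <- _) _]/(_ *m _) det_mulmx; congr (_ * _).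
  rewrite rmorphB /= horner_mx_X horner_mx_C -opprB -scaleN1r detZ.
  rewrite -horner_char_poly charA horner_prod -const -big_split /=.
  by apply: eq_bigr => z _; rewrite !hornerE; ring.
rewrite exchange_big /= -const -big_split /=.
apply: eq_bigr => z _; rewrite {2}qE hornerZ horner_prod.
congr (_ * _); apply: eq_bigr => w _; rewrite hornerXsubC //.
Qed.

(** The product is the determinant of [q] evaluated at the companion matrix of [p], whose entries
    are integers. *)
Lemma norm_horner_int (F : numClosedFieldType) (p q : {poly int})
    (rs : seq F) :
  p \is monic -> (1 < size p)%N -> map_poly intr p = \prod_(z <- rs) ('X - z%:P) ->
  exists k : int, \prod_(z <- rs) (map_poly intr q).[z] = k%:~R :> F.
Proof.
move=> p_monic; have := companionmxK p_monic; move: (companionmx p).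
case size_p : (size p) => [|[|n]] //= A charA _ pE.
exists (\det (horner_mx A q)).
rewrite -det_map_mx map_horner_mx; apply/esym/det_horner_mx.
by rewrite -map_char_poly charA.
Qed.

Lemma norm_real_complex (R : rcfType) (x : R) : `|x%:C%C| = `|x|%:C%C.
Proof. by rewrite normc_def /= expr0n addr0 sqrtr_sqr. Qed.

Lemma normr_horner_lt1 (F : numFieldType) (q : {poly int}) (b : int) (z : F) :
  (forall i, `|q`_i| <= b) -> `|z| < 1 ->
  `|(map_poly intr q).[z]| <= b%:~R / (1 - `|z|).
Proof.
move=> q_le z_lt1; have z1 : 0 < 1 - `|z| by rewrite subr_gt0.
have b_ge0 : 0 <= b by apply: le_trans (q_le 0%N).
rewrite horner_poly; apply: le_trans (ler_norm_sum _ _ _) _.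
apply: (@le_trans _ _ (b%:~R * \sum_(i < size q) `|z| ^+ i)).
  rewrite mulr_sumr; apply: ler_sum => i _.
  by rewrite normrM normrX ler_wpM2r ?exprn_ge0// -intr_norm ler_int.
apply: ler_wpM2l; first by rewrite ler0z.
rewrite -[leRHS]mul1r ler_pdivlMr// mulrC -opprB mulNr -subrX1 opprB.
by rewrite gerBl exprn_ge0.
Qed.

(** The product of the values of [q] over all roots of [p] is a nonzero integer, while the bound on
    the coefficients controls the factors at roots inside the unit disc. The constant does not
    depend on the degree of [q]. *)
Lemma pisot_separation (R : realType) (theta : R) (b : int) :
  pisot_number theta ->
  exists2 c : R, 0 < c & forall q : {poly int}, (forall i, `|q`_i| <= b) ->
    (map_poly intr q).[theta] != 0 -> c <= `|(map_poly intr q).[theta]|.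
Proof.
move=> [_ [p [p_monic p_irr p_root p_conj]]].
have hornerC (q : {poly int}) :
    (map_poly intr q).[theta%:C%C] = ((map_poly intr q).[theta])%:C%C :> R[i].
  rewrite -[RHS]/(real_complex R _) -horner_map -map_poly_comp.
  by congr (_.[_]); apply: eq_map_poly => k /=; rewrite rmorph_int.
have [rs pE] := closed_field_poly_normal (map_poly intr p : {poly R[i]}).
rewrite (monicP (monic_map _ p_monic)) scale1r in pE.
have size_p : (1 < size p)%N.
  by case: p_irr; rewrite size_map_inj_poly//; exact: intr_inj.
have theta_rs : theta%:C%C \in rs.
  by rewrite -root_prod_XsubC -pE /root hornerC (rootP p_root).
(* [theta] may be repeated in [rs]: the bound is only claimed for [q] with
   |q(theta)| <= 1, so that extra copies of [theta] contribute at most 1. *)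
have other (s : seq R[i]) : {subset s <= rs} -> exists2 B : R, 0 < B &
    forall q : {poly int}, (forall i, `|q`_i| <= b) ->
      `|(map_poly intr q).[theta]| <= 1 ->
      \prod_(z <- s) `|(map_poly intr q).[z]| <= B%:C%C.
  elim: s => [|z s IH] srs; first by exists 1 => // q _ _; rewrite big_nil.
  have [|B B0 HB] := IH; first by move=> y ys; apply: srs; rewrite inE ys orbT.
  have [B' B'0 HB'] : exists2 B' : R, 0 < B' &
      forall q : {poly int}, (forall i, `|q`_i| <= b) ->
      `|(map_poly intr q).[theta]| <= 1 -> `|(map_poly intr q).[z]| <= B'%:C%C.
    have [->|z_theta] := eqVneq z theta%:C%C.
      by exists 1 => // q _; rewrite hornerC norm_real_complex lecR.
    have z1 : `|z| < 1.
      by apply: p_conj z_theta; rewrite pE root_prod_XsubC srs ?mem_head.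
    have [t zE] : exists t : R, `|z| = t%:C%C
      by exists (complex.Re `|z|); rewrite normc_def.
    have t1 : 0 < 1 - t by rewrite subr_gt0 -ltcR -zE.
    (* The geometric bound is [b / (1 - t)]. The square and the added 1 make the constant positive
       whatever the sign of [b], which is known only once some [q] is given. *)
    exists (b%:~R ^+ 2 / (1 - t) + 1) => [|q qb _].
      by rewrite ltr_wpDl// divr_ge0 ?sqr_ge0// ltW.
    apply: (le_trans (@normr_horner_lt1 R[i] q b z qb z1)).
    rewrite zE -(rmorph1 (real_complex R)) -rmorphB -fmorphV.
    rewrite -(rmorph_int (real_complex R)) -rmorphM lecR ler_wpDr//.
    rewrite ler_wpM2r ?invr_ge0 ?(ltW t1)// -rmorphXn ler_int.
    have : 0 <= b by apply: le_trans (qb 0%N).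
    by rewrite expr2; nia.
  exists (B' * B); first exact: mulr_gt0.
  move=> q qb q1; rewrite big_cons rmorphM /=.
  by apply: ler_pM; rewrite ?prodr_ge0 ?HB ?HB'.
have [|B B0 HB] := other (rem theta%:C%C rs); first exact: mem_rem.
exists (Num.min 1 B^-1); first by rewrite lt_min ltr01 invr_gt0.
move=> q qb q_neq0; rewrite ge_min; have [//|/ltW q1] := leP 1 `|(map_poly intr q).[theta]|.
have [k kE] := @norm_horner_int R[i] p q rs p_monic size_p pE.
(* A zero norm makes [q] vanish at some root [z] of [p]. By irreducibility either [p] divides [q],
   so that [q] vanishes at [theta], or the two are coprime and cannot share [z]. *)
have k_neq0 : k != 0.
  apply: contraNneq q_neq0 => k0; move: kE; rewrite k0 => /eqP.
  rewrite prodf_seq_eq0 => /hasP[z z_rs /= qz].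
  have comp (F : numFieldType) (r : {poly int}) :
      map_poly intr r = map_poly (ratr : rat -> F) (map_poly intr r).
    by rewrite -map_poly_comp; apply: eq_map_poly => j /=; rewrite ratr_int.
  have [] := boolP (map_poly (intr : int -> rat) p %| map_poly intr q).
    rewrite -(dvdp_map (ratr : {rmorphism rat -> R})) -!comp => /dvdpP[r ->].
    by rewrite hornerM (rootP p_root) mulr0.
  rewrite -(irreducible_poly_coprime _ p_irr).
  rewrite -(coprimep_map (ratr : {rmorphism rat -> R[i]})) -!comp.
  move=> /coprimep_root co; have /co : root (map_poly intr p) z.
    by rewrite pE root_prod_XsubC.
  by rewrite (eqP qz) eqxx.
have : 1 <= `|k%:~R : R[i]|.
  by rewrite -intr_norm -[1]/(1%:~R) ler_int; lia.
rewrite -kE normr_prod (big_rem _ theta_rs)/= hornerC norm_real_complex => k1.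
have qB : `|(map_poly intr q).[theta]| * B >= 1.
  rewrite -lecR rmorphM rmorph1 /=; apply: le_trans k1 _.
  by apply: ler_wpM2l; [rewrite lecR | exact: HB].
by rewrite -[_^-1]mul1r ler_pdivrMr.
Qed.

(** * Counting words with the same or nearby values *)

(** The limit is the supremum of [u k / k] over positive [k]: Euclidean division of [n] by a nearly
    optimal [k] bounds [u n] from below, and [C] controls the loss due to the remainder. *)
Lemma fekete_superadditive (R : realType) (u : nat -> R) (C : R) :
  (forall m n, u m + u n <= u (m + n)%N) ->
  (forall n, 0 <= u n <= n%:R * C) ->
  cvgn (fun n => n%:R^-1 * u n).
Proof.
move=> u_add u_bnd; have C0 : 0 <= C.
  by have /andP[u0 u1] := u_bnd 1%N; rewrite -[C]mul1r (le_trans u0).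
pose E := [set n.+1%:R^-1 * u n.+1 | n in [set: nat]].
have E_ub : ubound E C.
  by move=> _ [n _ <-]; have /andP[_] := u_bnd n.+1; rewrite ler_pdivrMl.
have E_sup : has_sup E by split; [exists (1%:R^-1 * u 1%N), 0%N | exists C].
have u_mul k q : q%:R * u k <= u (q * k)%N.
  elim: q => [|q IH]; first by rewrite mul0r; have /andP[] := u_bnd (0 * k)%N.
  by rewrite mulSn -natr1 mulrDl mul1r addrC (le_trans _ (u_add _ _)) ?lerD2l.
apply/cvg_ex; exists (sup E); apply/cvgrPdist_le => e e0.
have e2 : 0 < e / 2 by rewrite divr_gt0.
have [_ [k _ <-] uk] := sup_adherent e2 E_sup.
near=> n.
have n0 : 0 < n%:R :> R by rewrite ltr0n; near: n; exists 1%N.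
rewrite ger0_norm.
  apply: (@le_trans _ _ (e / 2 + k.+1%:R * C / n%:R)); last first.
    rewrite [leRHS](splitr e) lerD2l ler_pdivrMr// -ler_pdivrMl//.
    near: n; exact: nbhs_infty_ger.
  have ukC : k.+1%:R^-1 * u k.+1 <= C by apply: E_ub; exists k.
  have : (n%:R - k.+1%:R) * (k.+1%:R^-1 * u k.+1) <= u n.
    rewrite mulrA; apply: (@le_trans _ _ ((n %/ k.+1)%:R * u k.+1)).
      apply: ler_wpM2r; first by have /andP[] := u_bnd k.+1.
      rewrite ler_pdivrMr// -natrM lerBlDr -natrD ler_nat.
      by rewrite {1}(divn_eq n k.+1) leq_add2l ltnW// ltn_pmod.
    rewrite {2}(divn_eq n k.+1); apply: le_trans (u_mul _ _) _.
    by apply: le_trans (u_add _ _); rewrite lerDl; have /andP[] := u_bnd (n %% k.+1)%N.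
  set X := _ * u k.+1 in uk ukC * => un.
  have : X - k.+1%:R * C / n%:R <= n%:R^-1 * u n.
    rewrite ler_pdivlMl// mulrBr [n%:R * (_ / _)]mulrC divfK ?gt_eqF//.
    by apply: le_trans un; rewrite mulrBl lerD2l lerN2 ler_pM2l.
  by lra.
rewrite subr_ge0; apply: ub_le_sup; first by exists C.
by exists n.-1 => //; rewrite prednK// -(ltr0n R).
Unshelve. all: by end_near. Qed.

(** Jensen's inequality, from the tangent line [ln x <= ln B + x / B - 1]. *)
Lemma avg_ln_le (R : realType) (T : finType) (f : T -> R) (B : R) :
  (0 < #|T|)%N -> (forall x, 0 < f x) -> \sum_x f x <= #|T|%:R * B ->
  \sum_x ln (f x) <= #|T|%:R * ln B.
Proof.
move=> T0 f0 fB; have T0' : 0 < #|T|%:R :> R by rewrite ltr0n.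
have B0 : 0 < B.
  rewrite -(pmulr_rgt0 _ T0') (lt_le_trans _ fB)//.
  move: T0 => /card_gt0P[x _].
  by rewrite (bigD1 x)//= ltr_pwDl// sumr_ge0// => *; exact: ltW.
have ln_fB x : ln (f x) <= ln B + (f x / B - 1).
  have fxB : 0 < f x / B by rewrite divr_gt0.
  rewrite -lerBlDl -ln_div ?posrE//.
  by rewrite -[X in ln X](subrKC 1) le_ln1Dx// ltrBrDl subrr.
apply: le_trans (ler_sum _ (fun x _ => ln_fB x)) _.
rewrite big_split /= sumr_const -[ln B *+ _]mulr_natl gerDl.
rewrite sumrB sumr_const -mulr_suml subr_le0.
by rewrite ler_pdivrMr// -mulr_natl mulr1.
Qed.

(** * Counting the values of a function with separated values *)

Section Multiplicity.
Context {R : realType} {T : finType}.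
Variable V : T -> R.

Definition multiplicity (x : T) : nat := #|[pred y | V y == V x]|.

Lemma multiplicity_gt0 x : (0 < multiplicity x)%N.
Proof. by apply/card_gt0P; exists x; rewrite inE. Qed.

(** The points sharing one value of [V] contribute at most 1 together, so the sum is at most the
    number of values taken on [P]. *)
Lemma sum_inv_multiplicity (P : pred T) (s a b : R) : 0 < s -> a <= b ->
  (forall x y, V x != V y -> s <= `|V x - V y|) ->
  (forall x, P x -> a <= V x <= b) ->
  \sum_(x | P x) (multiplicity x)%:R^-1 <= (b - a) / s + 1.
Proof.
move=> s0 ab sep Pab.
pose N := Num.trunc ((b - a) / s).
have ba0 : 0 <= (b - a) / s by rewrite divr_ge0 ?subr_ge0// ltW.
(* Cells of length [s]: by [sep], [V] is constant on each cell. *)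
pose g x : 'I_N.+1 := inord (Num.trunc ((V x - a) / s)).
rewrite (partition_big g predT)//=.
apply: (@le_trans _ _ (\sum_(j < N.+1) 1)); last first.
  by rewrite sumr_const card_ord -natr1 lerD2r truncn_le.
apply: ler_sum => j _.
have [[x0 /andP[Px0 /eqP gx0]]|none] := pselect (exists x0, P x0 && (g x0 == j)); last first.
  rewrite big_pred0 ?ler01// => x; apply/negbTE/negP => h; apply: none.
  by exists x.
have gE x : P x -> g x = Num.trunc ((V x - a) / s) :> nat /\ 0 <= (V x - a) / s.
  move=> /Pab /andP[ax xb]; rewrite divr_ge0 ?subr_ge0 ?(ltW s0)//; split => //.
  by rewrite inordK// ltnS; apply: le_truncn; rewrite ler_pM2r ?invr_gt0// lerD2r.
have VE x : P x && (g x == j) -> V x = V x0.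
  move=> /andP[Px /eqP gx]; apply/eqP; apply: contraT => /sep.
  have [gx1 vx] := gE _ Px; have [gx2 vx0] := gE _ Px0.
  have := truncn_itv vx; have := truncn_itv vx0.
  rewrite -gx1 -gx2 gx gx0 !ler_pdivlMr// !ltr_pdivrMr// -natr1 mulrDl mul1r.
  move=> /andP[h1 h2] /andP[h3 h4]; rewrite real_ler_normr ?num_real//.
  by move=> /orP[]; lra.
rewrite (eq_bigr (fun=> (multiplicity x0)%:R^-1)); last first.
  by move=> x /VE Vx; rewrite /multiplicity Vx.
rewrite sumr_const -[leLHS]mulr_natr ler_pdivrMl ?ltr0n ?multiplicity_gt0// mulr1 ler_nat.
by apply: subset_leq_card; apply/fintype.subsetP => x; rewrite !inE => /VE ->.
Qed.

Definition near_count (r : R) (x : T) : nat := #|[pred y | `|V y - V x| <= r]|.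

(** Double counting: for fixed [y], the inverse multiplicities of the points near [y] add up to the
    number of values of [V] within [r] of [V y]. *)
Lemma sum_near_count_div (s r : R) : 0 < s -> 0 <= r ->
  (forall x y, V x != V y -> s <= `|V x - V y|) ->
  \sum_x (near_count r x)%:R / (multiplicity x)%:R <= #|T|%:R * (2 * r / s + 1).
Proof.
move=> s0 r0 sep.
rewrite (eq_bigr (fun x => \sum_(y | `|V y - V x| <= r) (multiplicity x)%:R^-1)); last first.
  by move=> x _; rewrite sumr_const -[RHS]mulr_natl.
rewrite (exchange_big_dep predT)//= mulr_natl -sumr_const.
apply: ler_sum => y _.
apply: le_trans (@sum_inv_multiplicity _ s (V y - r) (V y + r) s0 _ sep _) _.
- by lra.
- by move=> x; rewrite distrC ler_distl.
- by rewrite lerD2r ler_pM2r ?invr_gt0//; lra.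
Qed.

End Multiplicity.

Lemma cvg_natV (R : realType) : (n%:R^-1 : R) @[n --> \oo] --> 0.
Proof.
apply/gtr0_cvgV0; last exact: cvgr_idn.
by exists 1%N => // n /= n0; rewrite ltr0n.
Qed.

(** * Values of words: separation and growth of multiplicities *)

Section WordValues.
Context {R : realType}.
Variable lam : R.
Hypotheses (lam0 : 0 < lam) (lam1 : lam < 1).

(* The word is reversed so that its last letter is applied last, as in
   [overlap_count]. *)
Definition word_val (w : seq bool) : R := phi_word (S_ifs lam) (rev w) 0.

Lemma phi_word_rev (w : seq bool) (x : R) :
  phi_word (S_ifs lam) (rev w) x = lam ^+ size w * x + word_val w.
Proof.
elim/last_ind: w x => [|w b IH] x; rewrite /word_val /phi_word.
  by rewrite /= mul1r addr0.
rewrite rev_rcons /= -!/(phi_word _ _ _) size_rcons IH [in RHS]IH /S_ifs exprS.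
by ring.
Qed.

Lemma word_val_rcons (w : seq bool) (b : bool) :
  word_val (rcons w b) = lam * word_val w + (if b then 1 else -1).
Proof. by rewrite {1}/word_val rev_rcons. Qed.

Lemma word_val_cat (w w' : seq bool) :
  word_val (w ++ w') = lam ^+ size w' * word_val w + word_val w'.
Proof. by rewrite -phi_word_rev /word_val rev_cat /phi_word foldr_cat. Qed.

Lemma word_val_bound (w : seq bool) : `|word_val w| <= (1 - lam)^-1.
Proof.
have l1 : 0 < 1 - lam by rewrite subr_gt0.
elim/last_ind: w => [|w b IH].
  by rewrite /word_val /= normr0 invr_ge0 ltW.
rewrite word_val_rcons; apply: le_trans (ler_normD _ _) _.
have -> : `|if b then 1 else -1 : R| = 1 by case: b; rewrite ?normrN normr1.
rewrite normrM gtr0_norm//.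
have : lam * `|word_val w| <= lam * (1 - lam)^-1 by rewrite ler_pM2l.
suff : lam * (1 - lam)^-1 + 1 = (1 - lam)^-1 by lra.
by field; rewrite gt_eqF.
Qed.

(** The letter of index [i] has weight [lam ^+ ((size w).-1 - i)]; factoring out the highest power
    leaves a polynomial in [lam^-1] whose degree grows with the word but whose coefficients do
    not. *)
Lemma word_val_sub_poly (w w' : seq bool) : size w = size w' ->
  exists q : {poly int}, [/\ (size q <= size w)%N, forall i, `|q`_i| <= 2 &
    word_val w - word_val w' =
      lam ^+ (size w).-1 * (map_poly intr q).[lam^-1]].
Proof.
elim/last_ind: w w' => [|w b IH] w'.
  move=> /esym/size0nil ->; exists 0; split => [|i|].
  - by rewrite size_poly0.
  - by rewrite coef0 normr0.
  - by rewrite subrr rmorph0 horner0 mulr0.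
case/lastP: w' => [|w' b']; rewrite !size_rcons// => -[szE].
have [q [sq qb qE]] := IH _ szE.
(* The sign of a letter [b] is [2 * b - 1], so two signs differ by [2 * (b - b')]. *)
exists (q + ((b : int) - (b' : int))%:P * 2%:P * 'X^(size w)); split => [|i|].
- rewrite (leq_trans (size_polyD _ _))// geq_max (leq_trans sq)//=.
  rewrite -polyCM (leq_trans (size_polyMleq _ _))//.
  rewrite size_polyXn addnS /= -[X in (_ <= X)%N]add1n leq_add2r.
  exact: size_polyC_leq1.
- rewrite coefD -polyCM coefCM coefXn; have [->|ni] := eqVneq i (size w).
    rewrite nth_default// add0r mulr1; by case: b; case: b'.
  by rewrite mulr0 addr0.
rewrite !word_val_rcons.
have -> : lam * word_val w + (if b then 1 else -1) -
    (lam * word_val w' + (if b' then 1 else -1)) =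
    lam * (word_val w - word_val w') + ((b : int) - (b' : int))%:~R * 2.
  by rewrite intrB /=; case: b; case: b' => /=; ring.
rewrite qE [map_poly _ (_ + _)]rmorphD hornerD [RHS]mulrDr; congr (_ + _).
  case: (w) sq => [|? ?] //=; last by rewrite mulrA -exprS.
  by rewrite leqn0 size_poly_eq0 => /eqP ->; rewrite rmorph0 horner0 !mulr0.
rewrite !rmorphM /= !map_polyC map_polyXn !hornerM !hornerC hornerXn.
by rewrite exprVn mulrCA divff ?mulr1// expf_neq0// gt_eqF.
Qed.

Lemma word_val_separation : pisot_number lam^-1 ->
  exists2 c : R, 0 < c & forall w w', size w = size w' ->
    word_val w != word_val w' ->
    c * lam ^+ size w <= `|word_val w - word_val w'|.
Proof.
move=> /(pisot_separation 2)[c c0 sep]; exists c => // w w' szE neq.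
have [q [_ qb qE]] := word_val_sub_poly szE.
rewrite qE normrM ger0_norm ?exprn_ge0 ?(ltW lam0)// mulrC.
have : lam ^+ size w <= lam ^+ (size w).-1.
  by rewrite ler_wiXn2l ?leq_pred// ltW.
have qc : c <= `|(map_poly intr q).[lam^-1]|.
  apply: sep => //; apply: contraNneq neq => q0.
  by rewrite -subr_eq0 qE q0 mulr0.
by move=> h; apply: ler_pM => //; rewrite ?exprn_ge0 ?ltW.
Qed.

Definition word_average (n : nat) (f : n.-tuple bool -> R) : R :=
  (2 ^+ n)^-1 * \sum_(w : n.-tuple bool) f w.

Definition avg_ln_multiplicity (n : nat) : R := word_average (fun w : n.-tuple bool =>
  ln (multiplicity (fun v : n.-tuple bool => word_val v) w)%:R).

(** The radius is [lam ^+ n] times the length of the interval of radius [(1 - lam)^-1] around 0,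
    which contains the limit set. *)
Definition avg_ln_near_count (n : nat) : R := word_average (fun w : n.-tuple bool =>
  ln (near_count (fun v : n.-tuple bool => word_val v)
       (2 * lam ^+ n / (1 - lam)) w)%:R).

Lemma card_words (n : nat) : #|{: n.-tuple bool}|%:R = 2 ^+ n :> R.
Proof. by rewrite card_tuple card_bool natrX. Qed.

Lemma avg_ln_multiplicity_ge0 n : 0 <= avg_ln_multiplicity n.
Proof.
rewrite mulr_ge0 ?invr_ge0 ?exprn_ge0// sumr_ge0// => w _.
by rewrite ln_ge0// ler1n multiplicity_gt0.
Qed.

Lemma avg_ln_multiplicity_le n : avg_ln_multiplicity n <= n%:R * ln 2.
Proof.
rewrite ler_pdivrMl ?exprn_gt0//.
rewrite -card_words [leRHS]mulr_natl -sumr_const ler_sum// => w _.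
rewrite mulr_natl -lnXn// ler_ln ?posrE ?ltr0n ?multiplicity_gt0// ?exprn_gt0//.
by rewrite -card_words ler_nat max_card.
Qed.

(** The value of a concatenation depends only on the values of its two parts, so concatenation
    embeds the product of two multiplicity classes into the class of the concatenated word. *)
Lemma avg_ln_multiplicity_superadd m n :
  avg_ln_multiplicity m + avg_ln_multiplicity n <= avg_ln_multiplicity (m + n).
Proof.
pose cat2 (p : m.-tuple bool * n.-tuple bool) := cat_tuple p.1 p.2.
have take_catK (v1 : m.-tuple bool) (v2 : n.-tuple bool) : take m (v1 ++ v2) = v1.
  by rewrite -{1}(size_tuple v1) take_size_cat.
have drop_catK (v1 : m.-tuple bool) (v2 : n.-tuple bool) : drop m (v1 ++ v2) = v2.
  by rewrite -{1}(size_tuple v1) drop_size_cat.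
have cat2_inj : injective cat2.
  move=> [v1 v2] [u1 u2] /(congr1 val) /= e; congr (_, _); apply: val_inj => /=.
    by rewrite -(take_catK v1 v2) e take_catK.
  by rewrite -(drop_catK v1 v2) e drop_catK.
have cat2_bij : bijective cat2.
  by apply: inj_card_bij => //; rewrite card_prod !card_tuple expnD.
rewrite /avg_ln_multiplicity /word_average.
rewrite [in leRHS](reindex cat2) /=; last exact: onW_bij.
pose f k (w : k.-tuple bool) : R :=
  ln (multiplicity (fun v : k.-tuple bool => word_val v) w)%:R.
rewrite -/(f m) -/(f n); set fm := f m; set fn := f n.
apply: (@le_trans _ _ ((2 ^+ (m + n))^-1 *
    \sum_(p : m.-tuple bool * n.-tuple bool) (fm p.1 + fn p.2))).
  rewrite -(pair_bigA _ (fun v u => fm v + fn u)) /=.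
  under [in leRHS]eq_bigr do rewrite big_split /= sumr_const -mulr_natl card_words.
  rewrite big_split /= sumr_const -[_ *+ #|_|]mulr_natl card_words -mulr_sumr.
  rewrite exprD invfM le_eqVlt; apply/orP; left; apply/eqP.
  by field; rewrite !expf_neq0// pnatr_eq0.
rewrite ler_pM2l ?invr_gt0 ?exprn_gt0//; apply: ler_sum => -[v u] _.
rewrite /fm /fn /f -lnM ?posrE ?ltr0n ?multiplicity_gt0// -natrM.
rewrite ler_ln ?posrE ?ltr0n ?muln_gt0 ?multiplicity_gt0// ler_nat.
rewrite -cardX -(fintype.card_image cat2_inj); apply: subset_leq_card.
apply/fintype.subsetP => _ /fintype.imageP[[v' u'] /andP[/= vv' uu'] ->].
rewrite !inE in vv' uu' *.
by rewrite /= !word_val_cat !size_tuple (eqP vv') (eqP uu').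
Qed.

(** The two averages differ by a bounded amount, so every sequence [u] between them has the same
    growth rate; the overlap integrals will be such a sequence. *)
Lemma overlap_limit : pisot_number lam^-1 ->
  exists2 l : R, ln (2 * lam) <= l &
    forall u : nat -> R,
      (forall n, avg_ln_multiplicity n <= u n <= avg_ln_near_count n) ->
      n%:R^-1 * u n @[n --> \oo] --> l.
Proof.
move=> /word_val_separation[c c0 sep].
have l1 : 0 < 1 - lam by rewrite subr_gt0.
have sepn n (x y : n.-tuple bool) : word_val x != word_val y ->
    c * lam ^+ n <= `|word_val x - word_val y|.
  by move=> /sep; rewrite !size_tuple; apply.
have s0 n : 0 < c * lam ^+ n by rewrite mulr_gt0 ?exprn_gt0.
(* [C / lam ^+ n] bounds the number of word values: they fill a range of length [2 / (1 - lam)] with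
   gaps at least [c * lam ^+ n], and the added 1 is at most [(lam ^+ n)^-1]. *)
pose C := 2 / (1 - lam) / c + 1.
have C0 : 0 < C by rewrite addr_gt0// !divr_gt0.
have T0 n : (0 < #|{: n.-tuple bool}|)%N by rewrite card_tuple card_bool expn_gt0.
have lower n : n%:R * ln (2 * lam) - ln C <= avg_ln_multiplicity n.
  pose m (w : n.-tuple bool) : R :=
    (multiplicity (fun v : n.-tuple bool => word_val v) w)%:R.
  have m0 w : 0 < m w by rewrite ltr0n multiplicity_gt0.
  have : \sum_w (m w)^-1 <= #|{: n.-tuple bool}|%:R * (C / (2 * lam) ^+ n).
    apply: le_trans (@sum_inv_multiplicity _ _ _ predT _ (- (1 - lam)^-1)
      (1 - lam)^-1 (s0 n) _ (@sepn n) _) _.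
    - by rewrite ge0_cp// invr_ge0 ltW.
    - by move=> w _; rewrite -ler_norml word_val_bound.
    have -> : #|{: n.-tuple bool}|%:R * (C / (2 * lam) ^+ n) =
        ((1 - lam)^-1 - - (1 - lam)^-1) / (c * lam ^+ n) + (lam ^+ n)^-1.
      have ln0 := lt0r_neq0 (exprn_gt0 n lam0).
      have l1' := lt0r_neq0 l1; have c0' := lt0r_neq0 c0.
      rewrite card_words exprMn /C; field.
      by rewrite ?ln0 ?l1' ?c0' ?expf_neq0 ?gt_eqF.
    by rewrite lerD2l invf_ge1 ?exprn_gt0// exprn_ile1// ltW.
  move=> /(avg_ln_le (T0 n)) h.
  have {h} := h (fun w => ltac:(by rewrite invr_gt0)).
  rewrite card_words ln_div ?posrE ?exprn_gt0// ?mulr_gt0//.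
  rewrite lnXn ?mulr_gt0// -[ln _ *+ n]mulr_natl.
  rewrite (eq_bigr (fun w => - ln (m w))) => [|w _]; last by rewrite lnV ?posrE.
  rewrite sumrN -lerN2 opprK -mulrN opprB => h.
  by rewrite /avg_ln_multiplicity /word_average ler_pdivlMl ?exprn_gt0.
have upper n : avg_ln_near_count n <= avg_ln_multiplicity n + ln (2 * C).
  pose m (w : n.-tuple bool) : R :=
    (multiplicity (fun v : n.-tuple bool => word_val v) w)%:R.
  pose r := 2 * lam ^+ n / (1 - lam).
  have r0 : 0 <= r by rewrite divr_ge0 ?(ltW l1)// mulr_ge0 ?exprn_ge0 ?(ltW lam0).
  pose k (w : n.-tuple bool) : R :=
    (near_count (fun v : n.-tuple bool => word_val v) r w)%:R.
  have m0 w : 0 < m w by rewrite ltr0n multiplicity_gt0.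
  have k0 w : 0 < k w.
    by rewrite ltr0n; apply/card_gt0P; exists w; rewrite inE subrr normr0.
  have := sum_near_count_div (s0 n) r0 (@sepn n).
  rewrite -/(m _) -/(k _) => h.
  have {h} : \sum_w (k w / m w) <= #|{: n.-tuple bool}|%:R * (2 * C).
    apply: le_trans h _; rewrite ler_pM2l ?ltr0n//.
    have -> : 2 * r / (c * lam ^+ n) = 2 * (2 / (1 - lam) / c).
      have ln0 := lt0r_neq0 (exprn_gt0 n lam0).
      have l1' := lt0r_neq0 l1; have c0' := lt0r_neq0 c0.
      by rewrite /r; field; rewrite ln0 c0' l1'.
    by rewrite /C mulrDr lerD2l; lra.
  move=> /(avg_ln_le (T0 n)) h.
  have {h} := h (fun w => ltac:(by rewrite divr_gt0)).
  rewrite (eq_bigr (fun w => ln (k w) - ln (m w))) => [|w _]; last by rewrite ln_div ?posrE.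
  rewrite sumrB lerBlDl card_words /avg_ln_near_count /avg_ln_multiplicity /word_average => h.
  by rewrite ler_pdivrMl ?exprn_gt0// [leRHS]mulrDr mulVKf.
have a_cvg : cvgn (fun n => n%:R^-1 * avg_ln_multiplicity n).
  apply: (fekete_superadditive avg_ln_multiplicity_superadd (C := ln 2)) => n.
  by rewrite avg_ln_multiplicity_ge0 avg_ln_multiplicity_le.
exists (limn (fun n => n%:R^-1 * avg_ln_multiplicity n)).
  have low_cvg : ln (2 * lam) - n%:R^-1 * ln C @[n --> \oo] --> ln (2 * lam).
    rewrite -[X in _ --> X]subr0 -[X in _ - X](mul0r (ln C)).
    apply: cvgB; first exact: cvg_cst.
    apply: cvgM; [|exact: cvg_cst].
    exact: cvg_natV.
  rewrite -(cvg_lim _ low_cvg)//; apply: ler_lim => //.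
    by apply/cvg_ex; eexists; exact: low_cvg.
  near=> n.
  have n0 : 0 < n%:R :> R by rewrite ltr0n; near: n; exists 1%N.
  by rewrite ler_pdivlMl// mulrBr mulVKf ?gt_eqF.
move=> u u_bnd.
have up_cvg : n%:R^-1 * avg_ln_multiplicity n + n%:R^-1 * ln (2 * C) @[n --> \oo] -->
   limn (fun n => n%:R^-1 * avg_ln_multiplicity n).
  rewrite -[X in _ --> X]addr0 -[X in _ + X](mul0r (ln (2 * C))).
  apply: cvgD => //; apply: cvgM; [|exact: cvg_cst].
  exact: cvg_natV.
apply: squeeze_cvgr a_cvg up_cvg.
near=> n; have /andP[au ub] := u_bnd n.
rewrite ler_wpM2l ?invr_ge0//= -mulrDr ler_wpM2l ?invr_ge0//.
exact: le_trans (upper n).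
Unshelve. all: by end_near. Qed.

End WordValues.

(** * Entropy of finite partitions *)

(** The weak inequality at the square root gives [ln x <= 2 * (Num.sqrt x - 1)], which falls short
    of [x - 1] by the positive square [(Num.sqrt x - 1) ^+ 2]. *)
Lemma lt_ln_sub1 (R : realType) (x : R) : 0 < x -> x != 1 -> ln x < x - 1.
Proof.
move=> x0 x1; have sx0 : 0 < Num.sqrt x by rewrite sqrtr_gt0.
have sx1 : Num.sqrt x != 1.
  by apply: contraNneq x1 => sx; rewrite -(sqr_sqrtr (ltW x0)) sx expr1n.
have : ln (Num.sqrt x) <= Num.sqrt x - 1.
  by rewrite -{1}[Num.sqrt x](subrKC 1) le_ln1Dx// ltrBrDl subrr.
have : 0 < (Num.sqrt x - 1) ^+ 2 by rewrite exprn_even_gt0//= subr_eq0.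
have -> : ln x = 2 * ln (Num.sqrt x).
  by rewrite -{1}(sqr_sqrtr (ltW x0)) lnXn// mulr_natl.
by have := sqr_sqrtr (ltW x0); rewrite !expr2; lra.
Qed.

(** * Gibbs' inequality and its equality case *)

Section Gibbs.
Context {R : realType} {J : finType}.
Variables p q : J -> R.
Hypotheses (p_ge0 : forall j, 0 <= p j) (q_gt0 : forall j, p j != 0 -> 0 < q j).
Hypotheses (q_ge0 : forall j, 0 <= q j) (q_sum : \sum_j q j <= \sum_j p j).

Let gibbs_term j : p j * ln (q j) - p j * ln (p j) <= q j - p j.
Proof.
have [->|pj] := eqVneq (p j) 0; first by rewrite !mul0r !subr0.
have pj0 : 0 < p j by rewrite lt_neqAle eq_sym pj p_ge0.
rewrite -mulrBr -ln_div ?posrE ?q_gt0//.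
have qp0 : 0 < q j / p j by rewrite divr_gt0// q_gt0.
have h : ln (q j / p j) <= q j / p j - 1.
  by rewrite -[X in ln X](subrKC 1) le_ln1Dx// ltrBrDl subrr.
apply: le_trans (ler_wpM2l (p_ge0 j) h) _.
by rewrite mulrBr mulr1 [p j * _]mulrC divfK.
Qed.

Lemma gibbs_le : - \sum_j p j * ln (p j) <= - \sum_j p j * ln (q j).
Proof.
have : \sum_j (p j * ln (q j) - p j * ln (p j)) <= \sum_j (q j - p j).
  by apply: ler_sum => j _; exact: gibbs_term.
by move: q_sum; rewrite !sumrB => ? ?; lra.
Qed.

(** The gaps in the termwise inequality are nonnegative, so they all vanish; strictness of
    [ln x < x - 1] away from 1 forces [q j / p j = 1], and where [p j] is zero the gap is [q j]
    itself. *)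
Lemma gibbs_eq : - \sum_j p j * ln (q j) <= - \sum_j p j * ln (p j) ->
  forall j, p j = q j.
Proof.
move=> h.
have sum_eq : \sum_j ((q j - p j) - (p j * ln (q j) - p j * ln (p j))) = 0.
  apply/eqP; rewrite eq_le sumr_ge0 ?andbT; last first.
    by move=> j _; rewrite subr_ge0 gibbs_term.
  by move: q_sum h; rewrite !sumrB => ? ?; lra.
move=> j; have /eqP := sum_eq; rewrite psumr_eq0; last first.
  by move=> i _; rewrite subr_ge0 gibbs_term.
move=> /allP/(_ j (mem_index_enum _))/=.
have [->|pj] := eqVneq (p j) 0.
  by rewrite !mul0r !subr0 => /eqP.
have pj0 : 0 < p j by rewrite lt_neqAle eq_sym pj p_ge0.
rewrite -mulrBr -ln_div ?posrE ?q_gt0// subr_eq0 => /eqP e.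
have [/divr1_eq ->//|ne] := eqVneq (q j / p j) 1.
have := lt_ln_sub1 (divr_gt0 (q_gt0 pj) pj0) ne.
rewrite -(ltr_pM2l pj0) -e mulrBr mulr1 [p j * _]mulrC divfK//.
by rewrite ltxx.
Qed.

End Gibbs.

(** * Measurable labels with finitely many values *)

Section Labels.
Context {d : measure_display} {T : measurableType d}.
Implicit Types (J K : finType).

Definition measurable_label J (X : T -> J) : Prop :=
  forall j, measurable (X @^-1` [set j]).

Lemma measurable_label_preimage J (X : T -> J) (A : set J) :
  measurable_label X -> measurable (X @^-1` A).
Proof.
move=> mX; rewrite [X in measurable X](_ : _ =
    \big[setU/set0]_(j : J | `[< A j >]) X @^-1` [set j]).
  by apply: bigsetU_measurable => j _.
rewrite -bigcup_seq_cond; apply/seteqP; split => [x Ax|x [j /= /andP[_ /asboolP Aj] /= Xx]].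
  by exists (X x) => //=; rewrite mem_index_enum; apply/asboolP.
by move: Aj; rewrite -Xx.
Qed.

Lemma measurable_label_comp J K (X : T -> J) (f : J -> K) :
  measurable_label X -> measurable_label (f \o X).
Proof. by move=> mX k; rewrite comp_preimage; exact: measurable_label_preimage. Qed.

Lemma measurable_label_pair J K (X : T -> J) (Y : T -> K) :
  measurable_label X -> measurable_label Y -> measurable_label (fun x => (X x, Y x)).
Proof.
move=> mX mY [j k]; rewrite [X in measurable X](_ : _ =
  X @^-1` [set j] `&` Y @^-1` [set k]); first exact: measurableI.
by apply/seteqP; split => [x [<- <-]|x [/= <- <-]].
Qed.

Lemma measurable_label_ffun (I J : finType) (X : T -> {ffun I -> J}) :
  (forall i, measurable_label (fun x => X x i)) -> measurable_label X.
Proof.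
move=> mX g; rewrite [X in measurable X](_ : _ =
  \bigcap_(i in [set` enum I]) (fun x => X x i) @^-1` [set g i]).
  by apply: fin_bigcap_measurable => [|i _]; [exact: finite_seq|exact: mX].
apply/seteqP; split => [x Xg i _|x h]; first by rewrite /preimage/= Xg.
apply/ffunP => i.
by apply: h; rewrite /= mem_enum.
Qed.

End Labels.

Lemma measurable_label_map d d' (T : measurableType d) (U : measurableType d')
    (J : finType) (X : T -> J) (f : U -> T) :
  measurable_fun setT f -> measurable_label X -> measurable_label (X \o f).
Proof.
move=> mf mX j; rewrite comp_preimage -[X in measurable X]setTI.
exact: mf.
Qed.

Lemma measurable_fun_iter d (T : measurableType d) (f : T -> T) n :
  measurable_fun setT f -> measurable_fun setT (iter n f).
Proof.
move=> mf; elim: n => [|n IH]; first exact: measurable_id.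
exact: measurableT_comp mf IH.
Qed.

Lemma measurable_iterated_partition d (T : measurableType d) (J : finType)
    (X : T -> J) (f : T -> T) n :
  measurable_fun setT f -> measurable_label X ->
  measurable_label (iterated_partition f X n).
Proof.
move=> mf mX; apply: measurable_label_ffun => i.
rewrite (_ : (fun x => _) = X \o iter i f).
  by apply: measurable_label_map => //; exact: measurable_fun_iter.
by apply/funext => x /=; rewrite ffunE.
Qed.

Section PartitionEntropy.
Context {R : realType} {d : measure_display} {T : measurableType d}.
Variable mu : probability T R.
Implicit Types (J K : finType).

Definition label_mass J (X : T -> J) (j : J) : R := fine (mu (X @^-1` [set j])).

Lemma label_mass_ge0 J (X : T -> J) j : 0 <= label_mass X j.
Proof. exact: fine_ge0. Qed.

Lemma fine_probabilityK (A : set T) : measurable A -> (fine (mu A))%:E = mu A.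
Proof. by move=> mA; rewrite fineK// fin_num_measure. Qed.

Lemma label_mass_preimage J (X : T -> J) (A : pred J) : measurable_label X ->
  fine (mu (X @^-1` [set j | A j])) = \sum_(j | A j) label_mass X j.
Proof.
move=> mX; apply: EFin_inj.
rewrite fine_probabilityK; last exact: measurable_label_preimage.
rewrite -sumEFin.
rewrite (_ : X @^-1` _ = \bigcup_(j in [set` enum A]) X @^-1` [set j]); last first.
  apply/seteqP; split => [x /= Ax|x [j /= Aj Xx]].
    by exists (X x) => //=; rewrite mem_enum.
  by move: Aj; rewrite mem_enum -Xx.
rewrite measure_fin_bigcup//; last by move=> i j _ _ [x [/= -> ->]].
rewrite -fsbig_seq ?enum_uniq// big_enum/=.
by apply: eq_bigr => j _; rewrite fine_probabilityK.
Qed.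

Lemma label_mass_sum J (X : T -> J) : measurable_label X ->
  \sum_j label_mass X j = 1.
Proof.
move=> mX; rewrite -(label_mass_preimage predT)//.
by rewrite (_ : X @^-1` _ = setT) ?probability_setT// -subTset.
Qed.

Lemma partition_entropy_ge0 J (X : T -> J) : measurable_label X ->
  0 <= partition_entropy mu X.
Proof.
move=> mX; rewrite oppr_ge0 sumr_le0// => j _.
rewrite mulr_ge0_le0 ?label_mass_ge0// ln_le0// -(label_mass_sum mX) (bigD1 j)//=.
by rewrite lerDl sumr_ge0// => *; exact: label_mass_ge0.
Qed.

Lemma label_mass_comp J K (X : T -> J) (f : J -> K) (k : K) :
  measurable_label X ->
  label_mass (f \o X) k = \sum_(j | f j == k) label_mass X j.
Proof.
move=> mX; rewrite -(label_mass_preimage (fun j => f j == k))//.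
congr (fine (mu _)); apply/seteqP; split => x /=; first by move=> ->.
by move=> /eqP.
Qed.

Lemma label_mass_pair1 J K (X : T -> J) (Y : T -> K) j :
  measurable_label X -> measurable_label Y ->
  label_mass X j = \sum_k label_mass (fun x => (X x, Y x)) (j, k).
Proof.
move=> mX mY; rewrite (_ : X = fst \o (fun x => (X x, Y x)))//.
rewrite label_mass_comp; last exact: measurable_label_pair.
rewrite (reindex_onto (fun k => (j, k)) snd)/=; last by move=> [j' k] /= /eqP ->.
by apply: eq_bigl => k; rewrite !eqxx.
Qed.

Lemma label_mass_pair2 J K (X : T -> J) (Y : T -> K) k :
  measurable_label X -> measurable_label Y ->
  label_mass Y k = \sum_j label_mass (fun x => (X x, Y x)) (j, k).
Proof.
move=> mX mY; rewrite (_ : Y = snd \o (fun x => (X x, Y x)))//.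
rewrite label_mass_comp; last exact: measurable_label_pair.
rewrite (reindex_onto (fun j => (j, k)) fst)/=; last by move=> [j k'] /= /eqP ->.
by apply: eq_bigl => j; rewrite !eqxx.
Qed.

Lemma partition_entropy_comp_le J K (X : T -> J) (f : J -> K) :
  measurable_label X ->
  partition_entropy mu (f \o X) <= partition_entropy mu X.
Proof.
move=> mX; rewrite /partition_entropy lerN2.
rewrite [leRHS](eq_bigr (fun k => \sum_(j | f j == k)
    label_mass X j * ln (label_mass (f \o X) (f j)))); last first.
  move=> k _; rewrite -/(label_mass _ _) {1}label_mass_comp// mulr_suml.
  by apply: eq_bigr => j /eqP ->.
rewrite [leRHS](_ : _ = \sum_j label_mass X j * ln (label_mass (f \o X) (f j))).
  2: by rewrite [RHS](partition_big f predT).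
apply: ler_sum => j _.
rewrite -/(label_mass _ _); have [->|p0] := eqVneq (label_mass X j) 0.
  by rewrite !mul0r.
have p_gt0 : 0 < label_mass X j by rewrite lt_neqAle eq_sym p0 label_mass_ge0.
have le_p : label_mass X j <= label_mass (f \o X) (f j).
  rewrite label_mass_comp// (bigD1 j)//= lerDl sumr_ge0// => i _.
  exact: label_mass_ge0.
by rewrite ler_pM2l// ler_ln ?posrE// (lt_le_trans p_gt0).
Qed.

Lemma partition_entropy_le J K (X : T -> J) (Y : T -> K) : measurable_label X ->
  (forall x y, X x = X y -> Y x = Y y) ->
  partition_entropy mu Y <= partition_entropy mu X.
Proof.
move=> mX XY.
(* [f] reads [Y] at some point labelled [j]; labels with an empty fibre get the value at the default
   [point]. *)
pose f (j : J) : K := Y (xget point [set x | X x = j]).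
rewrite (_ : Y = f \o X); first exact: partition_entropy_comp_le.
apply/funext => x /=; apply: XY.
by have := xgetPex point (ex_intro (fun y => X y = X x) x erefl).
Qed.

(** Gibbs' inequality for the joint law against the product of its marginals. *)
Lemma partition_entropy_pair_le J K (X : T -> J) (Y : T -> K) :
  measurable_label X -> measurable_label Y ->
  partition_entropy mu (fun x => (X x, Y x)) <=
  partition_entropy mu X + partition_entropy mu Y.
Proof.
move=> mX mY; set Z := fun x => (X x, Y x).
have mZ : measurable_label Z by exact: measurable_label_pair.
have le1 j k : label_mass Z (j, k) <= label_mass X j.
  rewrite (label_mass_pair1 j mX mY) (bigD1 k)//= lerDl sumr_ge0// => *.
  exact: label_mass_ge0.
have le2 j k : label_mass Z (j, k) <= label_mass Y k.
  rewrite (label_mass_pair2 k mX mY) (bigD1 j)//= lerDl sumr_ge0// => *.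
  exact: label_mass_ge0.
have gt0 jk : label_mass Z jk != 0 -> 0 < label_mass X jk.1 /\ 0 < label_mass Y jk.2.
  case: jk => j k /= z0.
  have z_gt0 : 0 < label_mass Z (j, k) by rewrite lt_neqAle eq_sym z0 label_mass_ge0.
  by split; [exact: lt_le_trans z_gt0 (le1 j k)|exact: lt_le_trans z_gt0 (le2 j k)].
apply: le_trans (@gibbs_le R _ (label_mass Z)
  (fun jk => label_mass X jk.1 * label_mass Y jk.2) _ _ _ _) _.
- by move=> ?; exact: label_mass_ge0.
- by move=> jk /gt0[? ?]; exact: mulr_gt0.
- by move=> jk; rewrite mulr_ge0// label_mass_ge0.
- rewrite label_mass_sum// -(pair_bigA _ (fun j k => label_mass X j * label_mass Y k))/=.
  by under eq_bigr do rewrite -mulr_sumr label_mass_sum// mulr1; rewrite label_mass_sum.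
rewrite (eq_bigr (fun jk => label_mass Z jk * ln (label_mass X jk.1) +
   label_mass Z jk * ln (label_mass Y jk.2))); last first.
  move=> jk _; have [->|/gt0[x0 y0]] := eqVneq (label_mass Z jk) 0.
    by rewrite !mul0r addr0.
  by rewrite -mulrDr lnM.
rewrite big_split/= opprD /partition_entropy le_eqVlt; apply/orP; left; apply/eqP.
congr (- _ + - _).
  transitivity (\sum_j \sum_k label_mass Z (j, k) * ln (label_mass X j)).
    by rewrite pair_bigA; apply: eq_bigr => -[].
  by apply: eq_bigr => j _; rewrite -mulr_suml -label_mass_pair1.
transitivity (\sum_j \sum_k label_mass Z (j, k) * ln (label_mass Y k)).
  by rewrite pair_bigA; apply: eq_bigr => -[].
rewrite exchange_big/=.
by apply: eq_bigr => j _; rewrite -mulr_suml -label_mass_pair2.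
Qed.

Let uniform_sum J (X : T -> J) : measurable_label X ->
  - \sum_j label_mass X j * ln (#|J|%:R^-1) = ln #|J|%:R.
Proof.
move=> mX; rewrite -mulr_suml label_mass_sum// mul1r lnV ?opprK//.
rewrite posrE ltr0n; apply/card_gt0P; exists (X point) => //.
Qed.

Lemma partition_entropy_le_card J (X : T -> J) : measurable_label X ->
  partition_entropy mu X <= ln #|J|%:R.
Proof.
move=> mX; have J0 : 0 < #|J|%:R :> R.
  by rewrite ltr0n; apply/card_gt0P; exists (X point).
rewrite -(uniform_sum mX); apply: gibbs_le => //.
- by move=> ?; exact: label_mass_ge0.
- by move=> ? _; rewrite invr_gt0.
- by rewrite sumr_const -[leLHS]mulr_natl mulfV ?gt_eqF// label_mass_sum.
Qed.

(** Equality case of Gibbs' inequality against the uniform law; it will turn maximal entropy into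
    equidistribution of words. *)
Lemma partition_entropy_card_uniform J (X : T -> J) : measurable_label X ->
  ln #|J|%:R <= partition_entropy mu X -> forall j, label_mass X j = #|J|%:R^-1.
Proof.
move=> mX; have J0 : 0 < #|J|%:R :> R.
  by rewrite ltr0n; apply/card_gt0P; exists (X point).
rewrite -(uniform_sum mX); apply: gibbs_eq => //.
- by move=> ?; exact: label_mass_ge0.
- by move=> ? _; rewrite invr_gt0.
- by rewrite sumr_const -[leLHS]mulr_natl mulfV ?gt_eqF// label_mass_sum.
Qed.

End PartitionEntropy.

(** Gibbs' inequality against the law giving [1 - eta] to [j0] and [eta / K] to each other label.
    Since [eps] precedes the measure and the label, it can be fixed before an approximating
    partition is built. *)
Lemma partition_entropy_small (R : realType) (e : R) (J : finType) : 0 < e ->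
  exists2 eps : R, 0 < eps &
    forall d (T : measurableType d) (mu : probability T R) (X : T -> J) (j0 : J),
      measurable_label X -> 1 - label_mass mu X j0 <= eps ->
      partition_entropy mu X <= e.
Proof.
(* With this choice [- ln (1 - eta)] is [e / 2], and the labels other than [j0] cost at most
   [eps * L], again [e / 2]. *)
move=> e0; pose eta := 1 - expR (- (e / 2)).
have e2 : 0 < e / 2 by rewrite divr_gt0.
have eta0 : 0 < eta by rewrite subr_gt0 expR_lt1 oppr_lt0.
have eta1 : eta < 1 by rewrite gtrBl expR_gt0.
pose K : R := #|J|.+1%:R.
have K0 : 0 < K by rewrite ltr0n.
have etaK : 0 < eta / K by rewrite divr_gt0.
pose L := - ln (eta / K).
have L0 : 0 < L.
  rewrite oppr_gt0 ln_lt0// etaK ltr_pdivrMr// mul1r (lt_le_trans eta1)//.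
  by rewrite ler1n.
exists (e / 2 / L); first by rewrite divr_gt0.
move=> d T mu X j0 mX small.
have p1 : label_mass mu X j0 <= 1.
  rewrite -(label_mass_sum mu mX) (bigD1 j0)//= lerDl sumr_ge0// => *.
  exact: label_mass_ge0.
have rest : \sum_(j | j != j0) label_mass mu X j = 1 - label_mass mu X j0.
  by rewrite -(label_mass_sum mu mX) [in RHS](bigD1 j0)//= addrAC subrr add0r.
apply: le_trans (@gibbs_le R _ (label_mass mu X)
  (fun j => if j == j0 then 1 - eta else eta / K) _ _ _ _) _.
- by move=> ?; exact: label_mass_ge0.
- by move=> j _; case: ifP => _ //; rewrite subr_gt0.
- by move=> j; case: ifP => _; [rewrite subr_ge0 ltW|exact: ltW].
- rewrite label_mass_sum// (bigD1 j0)//= eqxx.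
  rewrite (eq_bigr (fun=> eta / K)) => [|j /negPf ->//].
  rewrite -lerBrDl subKr sumr_const -[leLHS]mulr_natl mulrCA -[leRHS]mulr1.
  rewrite ler_pM2l// ler_pdivrMr// mul1r ler_nat.
  by rewrite (leq_trans (max_card _)).
rewrite (bigD1 j0)//= eqxx (eq_bigr (fun j => label_mass mu X j * - L)); last first.
  by move=> j /negPf ->; rewrite opprK.
rewrite -mulr_suml rest mulrN opprD opprK {1}/eta subKr expRK mulrN opprK.
have : label_mass mu X j0 * (e / 2) <= e / 2 by rewrite ger_pMl.
by move: small; rewrite ler_pdivlMr// => ? ?; lra.
Qed.

(** * Entropy of itineraries under an invariant measure *)

Section InvariantEntropy.
Context {R : realType} {d : measure_display} {T : measurableType d}.
Variables (mu : probability T R) (f : T -> T).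
Hypotheses (mf : measurable_fun setT f) (muf : invariant_probability mu f).

Lemma invariant_probability_iter n : invariant_probability mu (iter n f).
Proof.
elim: n => [//|n IH] A mA.
rewrite (_ : iter n.+1 f @^-1` A = iter n f @^-1` (f @^-1` A)).
  by rewrite IH ?muf// -[X in measurable X]setTI; exact: mf.
by apply/seteqP; split => x /=; rewrite /preimage/= -iterS.
Qed.

Lemma partition_entropy_map (J : finType) (X : T -> J) : measurable_label X ->
  partition_entropy mu (X \o f) = partition_entropy mu X.
Proof.
move=> mX; rewrite /partition_entropy; congr (- _); apply: eq_bigr => j _.
by rewrite comp_preimage muf.
Qed.

End InvariantEntropy.

Section IteratedEntropy.
Context {R : realType} {d : measure_display} {T : measurableType d}.
Variables (mu : probability T R) (f : T -> T).
Hypotheses (mf : measurable_fun setT f) (muf : invariant_probability mu f).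

Lemma iterated_partitionP (J : finType) (X : T -> J) n x y :
  iterated_partition f X n x = iterated_partition f X n y <->
  forall k, (k < n)%N -> X (iter k f x) = X (iter k f y).
Proof.
split=> [/ffunP h k kn|h]; last by apply/ffunP => k; rewrite !ffunE h.
by have := h (Ordinal kn); rewrite !ffunE.
Qed.

(** The itinerary splits at time [m]; by invariance the second piece has the entropy of an itinerary
    started at time 0. *)
Lemma partition_entropy_iterated_add (J : finType) (X : T -> J) m n :
  measurable_label X ->
  partition_entropy mu (iterated_partition f X (m + n)) <=
  partition_entropy mu (iterated_partition f X m) +
  partition_entropy mu (iterated_partition f X n).
Proof.
move=> mX; have mXn k : measurable_label (iterated_partition f X k).
  exact: measurable_iterated_partition.
have mXf : measurable_label (iterated_partition f X n \o iter m f).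
  by apply: measurable_label_map => //; exact: measurable_fun_iter.
rewrite -[X in _ + X](partition_entropy_map (invariant_probability_iter mf muf m))//.
apply: le_trans (partition_entropy_pair_le _ (mXn m) mXf).
apply: partition_entropy_le; first exact: measurable_label_pair.
move=> x y [/iterated_partitionP h1 /iterated_partitionP h2].
apply/iterated_partitionP => k kmn; have [/h1//|mk] := ltnP k m.
have := h2 (k - m)%N; rewrite -!iterD subnK//; apply.
by rewrite ltn_subLR.
Qed.

Lemma partition_entropy_iterated0 (J : finType) (X : T -> J) :
  measurable_label X -> partition_entropy mu (iterated_partition f X 0) <= 0.
Proof.
move=> mX; have := partition_entropy_le_card mu
  (@measurable_iterated_partition _ _ _ X f 0 mf mX).
by rewrite card_ffun card_ord expn0 ln1.
Qed.

Lemma partition_entropy_iterated_mul (J : finType) (X : T -> J) m n :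
  measurable_label X ->
  partition_entropy mu (iterated_partition f X (n * m)) <=
  n%:R * partition_entropy mu (iterated_partition f X m).
Proof.
move=> mX; elim: n => [|n IH].
  by rewrite mul0r mul0n partition_entropy_iterated0.
rewrite mulSn (le_trans (partition_entropy_iterated_add _ _ mX))//.
by rewrite -natr1 mulrDl mul1r addrC lerD2r.
Qed.

Lemma partition_entropy_iterated_le (J : finType) (X : T -> J) n :
  measurable_label X ->
  partition_entropy mu (iterated_partition f X n) <= n%:R * partition_entropy mu X.
Proof.
move=> mX; have := partition_entropy_iterated_mul 1 n mX; rewrite muln1.
move=> /le_trans; apply; rewrite ler_wpM2l//.
apply: partition_entropy_le => // x y Xxy.
by apply/iterated_partitionP => -[].
Qed.

End IteratedEntropy.

(** * Entropy of the lift *)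

Section Approximation.
Context {R : realType} {d : measure_display} {T : measurableType d}.
Variables (mu : probability T R) (G : set (set T)).
Hypotheses (Gm : G `<=` measurable) (G0 : G set0).
Hypotheses (GC : forall A, G A -> G (~` A)).
Hypotheses (GU : forall A B, G A -> G B -> G (A `|` B)).

Definition symdiff (A B : set T) : set T := (A `\` B) `|` (B `\` A).

Lemma measurable_symdiff (A B : set T) :
  measurable A -> measurable B -> measurable (symdiff A B).
Proof. by move=> mA mB; apply: measurableU; exact: measurableD. Qed.

Definition approximable : set (set T) := [set A | measurable A /\
  forall e : R, 0 < e -> exists2 B, G B & (mu (symdiff A B) <= e%:E)%E].

Let approximableU A A' :
  approximable A -> approximable A' -> approximable (A `|` A').
Proof.
move=> [mA GA] [mA' GA']; split; first exact: measurableU.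
move=> e e0; have e2 : 0 < e / 2 by rewrite divr_gt0.
have [B GB AB] := GA _ e2; have [B' GB' AB'] := GA' _ e2.
exists (B `|` B'); first exact: GU.
have [mB mB'] := (Gm GB, Gm GB').
apply: (@le_trans _ _ (mu (symdiff A B `|` symdiff A' B'))).
  apply: le_measure; rewrite ?inE.
  - by apply: measurable_symdiff; exact: measurableU.
  - by apply: measurableU; exact: measurable_symdiff.
  - by move=> x; rewrite /symdiff /= !not_orE => ?; tauto.
rewrite [e]splitr EFinD; apply: le_trans (leeD AB AB').
by apply: measureU2; exact: measurable_symdiff.
Qed.

Let approximable0 : approximable set0.
Proof.
split=> // e e0; exists set0 => //.
by rewrite /symdiff !set0D setU0 measure0 lee_fin ltW.
Qed.

(** For a countable union, continuity from above makes what a long finite union misses small, and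
    finite unions are approximable. *)
Lemma approximable_sigma_algebra : sigma_algebra setT approximable.
Proof.
split => //.
- move=> A [mA GA]; split; first exact: measurableD.
  move=> e /GA[B GB AB]; exists (~` B); first exact: GC.
  rewrite (_ : symdiff _ _ = symdiff A B)// /symdiff.
  by apply/seteqP; split => x /=; have := EM (A x); have := EM (B x); tauto.
move=> A hA; have mA i : measurable (A i) by have [] := hA i.
have mU : measurable (\bigcup_i A i) by exact: bigcup_measurable.
split=> // e e0; have e2 : 0 < e / 2 by rewrite divr_gt0.
pose U n := \big[setU/set0]_(i < n) A i.
have hU n : approximable (U n).
  rewrite /U; elim: n => [|n IH]; first by rewrite big_ord0.
  by rewrite big_ord_recr/=; exact: approximableU.
pose D n := (\bigcup_i A i) `\` U n.
have mD n : measurable (D n).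
  by apply: measurableD => //; have [] := hU n.
have D_cvg : (mu \o D) n @[n --> \oo] --> mu (\bigcap_n D n).
  apply: nonincreasing_cvg_mu => //.
  - by rewrite (le_lt_trans (probability_le1 _ _))// ltry.
  - exact: bigcapT_measurable.
  - move=> m n mn; apply/subsetPset; apply: setDS.
    exact: subset_bigsetU.
have D0 : \bigcap_n D n = set0.
  rewrite -subset0 => x Dx; have [[i _ Aix] _] := Dx 0%N I.
  have [_ []] := Dx i.+1 I.
  by rewrite /U -bigcup_mkord; exists i => /=.
have [n Dn] : exists n, (mu (D n) <= (e / 2)%:E)%E.
  rewrite D0 measure0 in D_cvg.
  have /fine_cvgP[_ /cvgrPdist_lt/(_ _ e2)[N _ hN]] := D_cvg.
  exists N; have := hN N (leqnn N); rewrite sub0r normrN /= => /ltW.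
  by rewrite ger0_norm ?fine_ge0// -lee_fin fineK ?fin_num_measure.
have [_ /(_ _ e2)[B GB UB]] := hU n; exists B => //.
have mUn : measurable (U n) by have [] := hU n.
have mB := Gm GB.
apply: (@le_trans _ _ (mu (D n `|` symdiff (U n) B))).
  apply: le_measure; rewrite ?inE.
  - exact: measurable_symdiff.
  - by apply: measurableU => //; exact: measurable_symdiff.
  - have UA : U n `<=` \bigcup_i A i.
      by rewrite /U -bigcup_mkord => x [i _ Aix]; exists i.
    move=> x; rewrite /symdiff /D /=; have := EM (U n x); have := UA x.
    by rewrite /setD /setU /=; tauto.
rewrite [e]splitr EFinD; apply: le_trans (leeD Dn UB).
by apply: measureU2 => //; exact: measurable_symdiff.
Qed.

Lemma sigma_algebra_approximable : <<s G >> `<=` approximable.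
Proof.
apply: smallest_sub; first exact: approximable_sigma_algebra.
move=> A GA; split; first exact: Gm.
move=> e e0; exists A => //.
by rewrite /symdiff !setDv setU0 measure0 lee_fin ltW.
Qed.

End Approximation.

(** * Sets decided by finitely many symbols and fibre thresholds *)

Section LiftSpace.
Context {R : realType}.
Let T := (symbolic_space * measurableTypeR R)%type.

Lemma measurable_coordinate (k : nat) :
  measurable_label (fun w : symbolic_space => w k).
Proof. by move=> b; apply: sub_sigma_algebra; exists k, b. Qed.

Lemma measurable_lift_coordinate (k : nat) :
  measurable_label (fun p : T => p.1 k).
Proof.
exact: (measurable_label_map (measurable_fst : measurable_fun setT (fst : T -> _))
  (measurable_coordinate k)).
Qed.

Lemma measurable_to_symbolic d (U : measurableType d) (f : U -> symbolic_space) :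
  (forall k, measurable_label (fun x => f x k)) -> measurable_fun setT f.
Proof.
move=> mf; apply: (@measurability _ _ U symbolic_space setT f coordinate_sets) => //.
move=> _ [_ [k [b ->]] <-].
by rewrite setTI; exact: mf.
Qed.

Lemma measurable_fun_label_if d (U : measurableType d) (c : U -> bool) (a b : R) :
  measurable_label c ->
  measurable_fun setT (fun x => if c x then a else b : measurableTypeR R).
Proof.
move=> mc; apply: measurable_fun_ifT => //; apply: (measurable_fun_bool true).
by rewrite setTI; exact: mc.
Qed.

Lemma measurable_lift_map (lam : R) :
  measurable_fun setT (lift_map (S_ifs lam) : T -> T).
Proof.
apply: measurable_fun_pair.
  by apply: measurable_to_symbolic => k; exact: measurable_lift_coordinate.
apply: measurable_funD.
  by apply: measurable_funM => //; exact: measurable_snd.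
exact: measurable_fun_label_if (measurable_lift_coordinate 0).
Qed.

(** The fibre coordinate is observed only through half-lines because order is what the increasing
    fibre maps preserve. *)
Definition same_info (m : nat) (a : seq R) (p q : T) : Prop :=
  (forall k, (k < m)%N -> p.1 k = q.1 k) /\
  (forall x, x \in a -> (p.2 < x) = (q.2 < x)).

Definition info_sets : set (set T) := [set B | measurable B /\
  exists m a, forall p q, same_info m a p q -> B p -> B q].

Lemma same_info_sym m a p q : same_info m a p q -> same_info m a q p.
Proof. by move=> [h1 h2]; split => [k /h1|x /h2]. Qed.

Lemma same_info_catl m m' a a' p q :
  same_info (m + m') (a ++ a') p q -> same_info m a p q.
Proof.
move=> [h1 h2]; split => [k km|x xa]; first by apply: h1; rewrite ltn_addr.
by apply: h2; rewrite mem_cat xa.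
Qed.

Lemma same_info_catr m m' a a' p q :
  same_info (m + m') (a ++ a') p q -> same_info m' a' p q.
Proof.
move=> [h1 h2]; split => [k km|x xa]; first by apply: h1; rewrite ltn_addl.
by apply: h2; rewrite mem_cat xa orbT.
Qed.

Lemma info_sets0 : info_sets set0.
Proof. by split=> //; exists 0%N, [::]. Qed.

Lemma info_setsC A : info_sets A -> info_sets (~` A).
Proof.
move=> [mA [m [a h]]]; split; first exact: measurableC.
by exists m, a => p q /same_info_sym pq nAp Aq; apply: nAp; exact: h Aq.
Qed.

Lemma info_setsU A B : info_sets A -> info_sets B -> info_sets (A `|` B).
Proof.
move=> [mA [m [a hA]]] [mB [m' [a' hB]]]; split; first exact: measurableU.
exists (m + m')%N, (a ++ a') => p q pq [Ap|Bp]; [left|right].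
  exact: hA (same_info_catl pq) Ap.
exact: hB (same_info_catr pq) Bp.
Qed.

(** Both projections are measurable for the generated sigma-algebra: a coordinate set is decided by
    finitely many symbols, a half-line by one threshold. *)
Lemma measurable_info_sets : (measurable : set (set T)) `<=` <<s info_sets >>.
Proof.
have m1 : measurable_fun setT (fst : g_sigma_algebraType info_sets -> symbolic_space).
  apply: measurable_to_symbolic => k b; apply: sub_sigma_algebra; split.
    exact: measurable_lift_coordinate.
  exists k.+1, [::] => p q [h _]; rewrite /preimage/= => <-.
  by rewrite h.
have m2 : measurable_fun setT (snd : g_sigma_algebraType info_sets -> measurableTypeR R).
  apply: (@measurability _ _ (g_sigma_algebraType info_sets) (measurableTypeR R)
    setT snd (@RGenCInfty.G R)); first exact: RGenCInfty.measurableE.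
  move=> _ [_ [x ->] <-]; rewrite setTI; apply: sub_sigma_algebra; split.
    rewrite -[X in measurable X]setTI; apply: measurable_snd => //.
  exists 0%N, [:: x] => p q [_ h]; have := h x (mem_head _ _).
  by rewrite /preimage/= !in_itv/= !andbT !leNgt => ->.
apply: smallest_sub; first exact: smallest_sigma_algebra.
by rewrite subUset; split=> [|] A [C mC <-]; [exact: m1|exact: m2].
Qed.

End LiftSpace.

(** * Metric entropy of the lift is bounded by that of the symbols *)

Section LiftEntropy.
Context {R : realType}.
Let T := (symbolic_space * measurableTypeR R)%type.
Variable lam : R.
Hypothesis lam0 : 0 < lam.
Let F : T -> T := lift_map (S_ifs lam).

Definition first_symbol (p : symbolic_space * measurableTypeR R) : bool := p.1 0%N.
Let alpha (n : nat) := iterated_partition F first_symbol n.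

Lemma iter_lift_fst k (p : T) j : (iter k F p).1 j = p.1 (k + j)%N.
Proof. by elim: k j => [//|k IH] j; rewrite iterS /= IH addnS. Qed.

Let malpha (n : nat) : measurable_label (alpha n).
Proof.
apply: measurable_iterated_partition; first exact: measurable_lift_map.
exact: measurable_lift_coordinate.
Qed.

Lemma first_symbols_eqP n (p q : T) :
  alpha n p = alpha n q <-> forall k, (k < n)%N -> p.1 k = q.1 k.
Proof.
rewrite iterated_partitionP; split => h k /h; rewrite /first_symbol !iter_lift_fst addn0//.
Qed.

Lemma iter_lift_snd_le k (p q : T) : (forall j, (j < k)%N -> p.1 j = q.1 j) ->
  p.2 <= q.2 -> (iter k F p).2 <= (iter k F q).2.
Proof.
elim: k => [//|k IH] h pq; rewrite !iterS /F /= /S_ifs -/F !iter_lift_fst addn0.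
rewrite h// lerD2r ler_pM2l// IH// => j jk.
by rewrite h// ltnS ltnW.
Qed.

Variable mu : probability T R.

(** The itinerary is determined by the first [n + m] symbols and the number of threshold
    inequalities holding along the orbit; that number has [n * size a + 1] possible values, whence
    the logarithm. *)
Lemma partition_entropy_info_le (J : finType) (X : T -> J) m a n :
  measurable_label X -> (forall p q, same_info m a p q -> X p = X q) ->
  partition_entropy mu (iterated_partition F X n) <=
  partition_entropy mu (alpha (n + m)) + ln (n * size a).+1%:R.
Proof.
move=> mX infoX.
pose bits (p : T) : {ffun 'I_n * 'I_(size a) -> bool} :=
  [ffun ki : 'I_n * 'I_(size a) => (iter ki.1 F p).2 < nth 0 a ki.2].
(* Over a fixed symbol sequence the sets [bits p] form a chain, since the fibre
   maps are increasing, so their cardinal determines them. *)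
pose count (b : {ffun 'I_n * 'I_(size a) -> bool}) : 'I_(n * size a).+1 :=
  inord #|[pred ki | b ki]|.
have mbits : measurable_label bits.
  apply: measurable_label_ffun => -[k i].
  rewrite (_ : (fun x => _) = (fun p : T => p.2 < nth 0 a i) \o iter k F); last first.
    by apply/funext => p; rewrite /= ffunE.
  apply: measurable_label_map.
    exact: measurable_fun_iter (measurable_lift_map lam).
  move=> b; rewrite -[X in measurable X]setTI.
  apply: (measurable_fun_ltr measurable_snd (measurable_cst _)) => //.
have mcount := measurable_label_comp count mbits.
rewrite -[(n * size a).+1]card_ord.
apply: (@le_trans _ _ (partition_entropy mu (alpha (n + m)) +
    partition_entropy mu (count \o bits))); last first.
  by rewrite lerD2l; exact: partition_entropy_le_card.
apply: le_trans _ (partition_entropy_pair_le mu (@malpha (n + m)%N) mcount).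
apply: partition_entropy_le; first exact: measurable_label_pair.
suff bitsP p q : alpha (n + m) p = alpha (n + m) q -> count (bits p) = count (bits q) ->
    p.2 <= q.2 -> bits p = bits q.
  move=> p q [apq cpq]; have bpq : bits p = bits q.
    by have [pq|/ltW qp] := leP p.2 q.2; [exact: bitsP|apply/esym/bitsP].
  move/first_symbols_eqP: apq => apq.
  apply/iterated_partitionP => k kn; apply: infoX; split => [j jm|x xa].
    by rewrite !iter_lift_fst apq// -addnS leq_add// ltnW.
  have ia : (index x a < size a)%N by rewrite index_mem.
  have /ffunP/(_ (Ordinal kn, Ordinal ia)) := bpq.
  by rewrite !ffunE/= nth_index.
move=> /first_symbols_eqP apq cpq pq.
have card_lt (b : {ffun 'I_n * 'I_(size a) -> bool}) :
    (#|[pred ki | b ki]| < (n * size a).+1)%N.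
  by rewrite ltnS (leq_trans (max_card _))// card_prod !card_ord.
(* The orbit of the lower point [p] stays below that of [q], so each inequality true for [q] is true
   for [p]; equal cardinals then give equality. *)
have sub : {subset [pred ki | bits q ki] <= [pred ki | bits p ki]}.
  move=> [k i]; rewrite !inE !ffunE/=; apply: le_lt_trans.
  apply: iter_lift_snd_le => // j jk; rewrite apq// ltn_addr//.
  exact: ltn_trans jk (ltn_ord k).
have /subset_cardP : #|[pred ki | bits q ki]| = #|[pred ki | bits p ki]|.
  by move/(congr1 val): cpq; rewrite /= !inordK.
move=> /(_ (introT fintype.subsetP sub)) eqb.
by apply/ffunP => ki; have := eqb ki; rewrite !inE => ->.
Qed.

Hypothesis muF : invariant_probability mu F.

Let mF : measurable_fun setT F := measurable_lift_map lam.

(** Each atom is approximated within [e / K], and [X'] picks an atom whose approximating set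
    contains the point, or [None] if there is no such atom. *)
Lemma info_partition_approx (J : finType) (X : T -> J) (e : R) :
  measurable_label X -> 0 < e ->
  exists (m : nat) (a : seq R) (X' : T -> option J),
    [/\ measurable_label X', forall p q, same_info m a p q -> X' p = X' q &
        (mu [set p | X' p <> Some (X p)] <= e%:E)%E].
Proof.
have [j0 _] : exists j0 : J, True by exists (X point).
pose K : R := #|J|%:R.
have K0 : 0 < K by rewrite ltr0n; apply/card_gt0P; exists j0.
move=> mX e0; have eK : 0 < e / K by rewrite divr_gt0.
have approxX j : exists B, info_sets B /\ (mu (symdiff (X @^-1` [set j]) B) <= (e / K)%:E)%E.
  have := @sigma_algebra_approximable _ _ _ mu (@info_sets R)
    (fun A => @proj1 _ _) (@info_sets0 R) (@info_setsC R) (@info_setsU R) _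
    (measurable_info_sets (mX j)).
  by move=> [_ /(_ _ eK)[B ? ?]]; exists B.
have [B hB] := choice approxX.
have mB j : measurable (B j) by have [[]] := hB j.
have [m [a infoB]] : exists m a, forall p q, same_info m a p q ->
    forall j, B j p -> B j q.
  suff [m [a h]] : exists m a, forall p q, same_info m a p q ->
      forall j, j \in enum J -> B j p -> B j q.
    by exists m, a => p q pq j; apply: h _ _ pq _ _; rewrite mem_enum.
  elim: (enum J) => [|j s [m [a IH]]]; first by exists 0%N, [::].
  have [[_ [m' [a' h]]] _] := hB j.
  exists (m + m')%N, (a ++ a') => p q pq i; rewrite inE => /orP[/eqP ->|si].
    exact: h _ _ (same_info_catr pq).
  exact: IH _ _ (same_info_catl pq) i si.
pose bits p := [ffun j => `[< B j p >]].
pose X' p := [pick j | bits p j].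
have mX' : measurable_label X'.
  apply: (measurable_label_comp (fun b : {ffun J -> bool} => [pick j | b j])).
  apply: measurable_label_ffun => j.
  rewrite (_ : (fun p => _) = (fun p => `[< B j p >])); last first.
    by apply/funext => p; rewrite ffunE.
  move=> [].
    by rewrite (_ : _ @^-1` _ = B j)//; apply/seteqP; split => p /asboolP.
  rewrite (_ : _ @^-1` _ = ~` B j); first exact: measurableC.
  apply/seteqP; split => [p|p Bp]; last by rewrite /preimage/= asboolF.
  by rewrite /preimage/= => pB Bp; rewrite asboolT in pB.
exists m, a, X'; split=> //.
- move=> p q pq; rewrite /X'; apply: eq_pick => j; rewrite !ffunE.
  by apply/asboolP/asboolP; apply: infoB => //; exact: same_info_sym.
have mS j : measurable (symdiff (X @^-1` [set j]) (B j)) by exact: measurable_symdiff.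
apply: (@le_trans _ _ (mu (\big[setU/set0]_(j <- enum J) symdiff (X @^-1` [set j]) (B j)))).
  apply: le_measure; rewrite ?inE.
  - exact: (measurable_label_preimage [set y | y.1 <> Some y.2]
      (measurable_label_pair mX' mX)).
  - by apply: bigsetU_measurable => j _.
  - move=> p /= X'p; apply: contrapT; rewrite -bigcup_seq => nS.
    (* Outside all the symmetric differences the approximating sets agree with the atoms, so the
       picked label is the right one. *)
    have BE j : B j p <-> X p = j.
      have := EM (B j p); have := EM (X p = j) => EX EB.
      have : ~ symdiff (X @^-1` [set j]) (B j) p.
        by move=> ?; apply: nS; exists j => //=; rewrite mem_enum.
      rewrite /symdiff /setD /setU /=; tauto.
    apply: X'p; rewrite /X'; case: pickP => [j|/(_ (X p))].
      by rewrite ffunE => /asboolP/BE ->.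
    by rewrite ffunE => /asboolP; case; apply/BE.
apply: (@le_trans _ _ (\sum_(j <- enum J) mu (symdiff (X @^-1` [set j]) (B j)))%E).
  elim: (enum J) => [|j s IH]; first by rewrite !big_nil measure0.
  rewrite !big_cons; apply: le_trans (leeD2l _ IH); apply: measureU2 => //.
  by apply: bigsetU_measurable => *.
apply: (@le_trans _ _ (\sum_(j <- enum J) (e / K)%:E)%E).
  by apply: lee_sum => j _; have [] := hB j.
rewrite sumEFin lee_fin big_enum/= sumr_const -[leLHS]mulr_natl.
by rewrite mulrC divfK ?gt_eqF.
Qed.

Lemma partition_entropy_lift_approx (J : finType) (X : T -> J) (e : R) :
  measurable_label X -> 0 < e ->
  exists m L : nat, forall n, partition_entropy mu (iterated_partition F X n) <=
    partition_entropy mu (alpha (n + m)) + ln (n * L).+1%:R + n%:R * e.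
Proof.
move=> mX e0; have [eps eps0 small] := partition_entropy_small (option J) e0.
have [m [a [X' [mX' infoX' XX']]]] := info_partition_approx mX eps0.
exists m, (size a) => n.
(* [X] is recovered from [X'] and the error label [E], which has small entropy
   because [E = None] with high probability. *)
pose E p := if X' p == Some (X p) then None else Some (X p).
have mE : measurable_label E.
  rewrite (_ : E = (fun y => if y.1 == Some y.2 then None else Some y.2) \o
    (fun p => (X' p, X p)))//.
  by apply: measurable_label_comp; exact: measurable_label_pair.
have HE : partition_entropy mu E <= e.
  apply: (small _ _ _ _ None mE).
  rewrite -lee_fin EFinB fine_probabilityK//; apply: le_trans XX'.
  rewrite -probability_setC//.
  rewrite (_ : ~` _ = [set p | X' p <> Some (X p)])//.
  apply/seteqP; split => p; rewrite /E /preimage/=; first by case: eqP.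
  by case: eqP.
have mXn (K : finType) (Y : T -> K) : measurable_label Y ->
    measurable_label (iterated_partition F Y n).
  exact: measurable_iterated_partition.
apply: (@le_trans _ _ (partition_entropy mu (iterated_partition F X' n) +
    partition_entropy mu (iterated_partition F E n))).
  apply: le_trans (partition_entropy_pair_le mu (mXn _ _ mX') (mXn _ _ mE)).
  apply: partition_entropy_le.
    by apply: measurable_label_pair; exact: mXn.
  move=> p q [/iterated_partitionP h1 /iterated_partitionP h2].
  apply/iterated_partitionP => k kn; have := h1 k kn; have := h2 k kn.
  rewrite /E => eE eX'; move: eE; rewrite eX'.
  case: eqP => [e1|_]; case: eqP => [e2|_] //; last by move=> [].
  by move: e1; rewrite e2 => -[].
apply: lerD; first exact: partition_entropy_info_le.
apply: le_trans (partition_entropy_iterated_le mF muF n mE) _.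
by rewrite ler_wpM2l.
Qed.

(** Tangent line of the logarithm at [A], chosen so that its slope times [L] is at most [e]. *)
Lemma ln_linear_bound (L : nat) (e : R) : 0 < e ->
  exists C : R, forall n : nat, ln (n * L).+1%:R <= n%:R * e + C.
Proof.
move=> e0; pose A : R := L.+1%:R / e.
have A0 : 0 < A by rewrite divr_gt0.
exists (A^-1 + ln A) => n.
have x0 : 0 < (n * L).+1%:R :> R by rewrite ltr0n.
have := @le_ln1Dx R ((n * L).+1%:R / A - 1).
rewrite subrKC ltrBrDl subrr divr_gt0// ln_div ?posrE// => /(_ isT) h.
have : (n * L).+1%:R / A <= n%:R * e + A^-1.
  rewrite -natr1 mulrDl mul1r lerD2r natrM -mulrA ler_wpM2l//.
  by rewrite /A invf_div mulrCA ger_pMr// ler_pdivrMr ?ltr0n// mul1r ler_nat.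
lra.
Qed.

(** One block length controls everything: subadditivity propagates the bound to all lengths, and
    other partitions add only an arbitrarily small rate. [N = 1] will give the bound [ln 2]; larger
    [N] will detect words that are not equidistributed. *)
Lemma metric_entropy_lift_le (N : nat) (c : R) : (0 < N)%N -> 0 <= c ->
  partition_entropy mu (alpha N) <= N%:R * c ->
  (metric_entropy mu F <= c%:E)%E.
Proof.
move=> N0 c0 HN; apply: ge_ereal_sup => _ [k [X [mX ->]]]; rewrite lee_fin.
have mfs : measurable_label first_symbol by exact: measurable_lift_coordinate.
(* The additive [N%:R * c] pays for rounding [n] up to a multiple of [N]. *)
have Halpha n : partition_entropy mu (alpha n) <= n%:R * c + N%:R * c.
  have nN : (n <= (n %/ N).+1 * N)%N by rewrite ltnW// ltn_ceil.
  apply: (@le_trans _ _ (partition_entropy mu (alpha ((n %/ N).+1 * N)))).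
    apply: partition_entropy_le => // p q /first_symbols_eqP h.
    by apply/first_symbols_eqP => j jn; rewrite h// (leq_trans jn).
  apply: le_trans (partition_entropy_iterated_mul mF muF _ _ mfs) _.
  apply: le_trans (ler_wpM2l _ HN) _ => //.
  rewrite mulrA -natrM mulSn addnC natrD mulrDl lerD2r ler_wpM2r// ler_nat.
  exact: leq_trunc_div.
have bound e : 0 < e -> exists C : R, forall n,
    partition_entropy mu (iterated_partition F X n) <= n%:R * (c + e) + C.
  move=> e0; have e2 : 0 < e / 2 by rewrite divr_gt0.
  have [m [L h]] := partition_entropy_lift_approx mX e2.
  have [C hC] := ln_linear_bound L e2.
  exists (m%:R * c + N%:R * c + C) => n.
  apply: le_trans (h n) _; have := Halpha (n + m)%N; have := hC n.
  by rewrite natrD; lra.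
rewrite /entropy_wrt; set u := fun n => _.
(* [limn] of a divergent real sequence is the junk value 0. *)
have [u_cvg|u_dvg] := pselect (cvgn u); last first.
  suff -> : limn u = 0 by [].
  by rewrite /lim /lim_in /= xgetPN// => l ul; apply: u_dvg; apply/cvg_ex; exists l.
apply/ler_addgt0Pl => e e0; have e2 : 0 < e / 2 by rewrite divr_gt0.
have [C hC] := bound _ e2.
apply: limr_le => //; near=> n.
have n0 : 0 < n%:R :> R by rewrite ltr0n; near: n; exists 1%N.
rewrite /u ler_pdivrMr//; apply: le_trans (hC n) _.
have : C <= n%:R * (e / 2).
  rewrite -ler_pdivrMr//; near: n; exact: nbhs_infty_ger.
lra.
Unshelve. all: by end_near. Qed.

End LiftEntropy.

(** * Existence of a measure of maximal entropy *)

Section BernoulliMeasure.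
Context {R : realType}.

Definition binary_digits (t : measurableTypeR R) : symbolic_space :=
  fun k => odd (Num.trunc (2 ^+ k.+1 * t)).

Lemma measurable_binary_digits : measurable_fun setT binary_digits.
Proof.
apply: measurable_to_symbolic => k.
have c0 : 0 < 2 ^+ k.+1 :> R by rewrite exprn_gt0.
have mtrue : measurable [set t : measurableTypeR R | odd (Num.trunc (2 ^+ k.+1 * t))].
  (* The digit is 1 exactly on the dyadic intervals of odd index; a negative [t] has truncation 0,
     hence digit 0. *)
  rewrite (_ : [set t | _] = \bigcup_n
      `[(n.*2.+1)%:R / 2 ^+ k.+1, (n.*2.+2)%:R / 2 ^+ k.+1[%classic).
    by apply: bigcup_measurable => n _; exact: measurable_itv.
  apply/seteqP; split => t /=.
    set x := 2 ^+ k.+1 * t => ot.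
    have x0 : 0 <= x.
      rewrite leNgt; apply/negP => x0; move: ot.
      by rewrite truncn_floor leNgt x0.
    exists (Num.trunc x)./2 => //=.
    have -> : (Num.trunc x)./2.*2.+1 = Num.trunc x.
      by rewrite -[RHS]odd_double_half ot.
    by rewrite in_itv/= ler_pdivrMr// ltr_pdivlMr// ![t * _]mulrC truncn_itv.
  move=> [n _]; rewrite /= in_itv/= ler_pdivrMr// ltr_pdivlMr// ![t * _]mulrC.
  by move=> /truncn_def ->; rewrite /= odd_double.
move=> [] //.
rewrite (_ : _ @^-1` _ = ~` [set t | odd (Num.trunc (2 ^+ k.+1 * t))]).
  exact: measurableC.
apply/seteqP; split => t; rewrite /preimage/= /binary_digits; first by move=> ->.
by move=> /negP/negbTE.
Qed.

HB.instance Definition _ := @isMeasurableFun.Build _ _ _ _ binary_digits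
  measurable_binary_digits.

Definition unit_interval : set (measurableTypeR R) := `[0, 1[%classic.

Lemma measurable_unit_interval : measurable unit_interval.
Proof. exact: measurable_itv. Qed.

Let restricted_lebesgue : {measure set (measurableTypeR R) -> \bar R} :=
  mrestr lebesgue_measure measurable_unit_interval.

(* The binary digits of a uniform point of [0, 1[ are independent fair bits. *)
Definition bernoulli_measure : set symbolic_space -> \bar R :=
  pushforward restricted_lebesgue binary_digits.

Let bernoulli_measure0 : bernoulli_measure set0 = 0%E.
Proof. by rewrite /bernoulli_measure /pushforward preimage_set0 measure0. Qed.

Let bernoulli_measure_ge0 A : (0 <= bernoulli_measure A)%E.
Proof. exact: measure_ge0. Qed.

Let bernoulli_measure_sigma_additive : semi_sigma_additive bernoulli_measure.
Proof.
exact: (@measure_semi_sigma_additive _ _ _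
  (measure_function_pushforward__canonical__measure_function_Measure
    restricted_lebesgue measurable_binary_digits)).
Qed.

HB.instance Definition _ := isMeasure.Build _ _ _ bernoulli_measure
  bernoulli_measure0 bernoulli_measure_ge0 bernoulli_measure_sigma_additive.

Let bernoulli_measureT : bernoulli_measure setT = 1%E.
Proof.
rewrite -[LHS]/(lebesgue_measure (setT `&` unit_interval)).
by rewrite setTI lebesgue_measure_itv/= lte_fin ltr01 oppr0 adde0.
Qed.

HB.instance Definition _ := Measure_isProbability.Build _ _ _
  bernoulli_measure bernoulli_measureT.

Definition symbol_shift (w : nat -> bool) : nat -> bool := fun k => w k.+1.

(** Both sides are measures in [S] agreeing on half-open intervals, and Lebesgue measure is unique
    with these values. *)
Lemma lebesgue_halving (b : bool) (S : set (measurableTypeR R)) : measurable S ->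
  (lebesgue_measure S = 2%:E * lebesgue_measure [set t : R | S ((2 * t - b%:R)%R)])%E.
Proof.
pose g (t : measurableTypeR R) : measurableTypeR R := 2 * t - b%:R.
have mg : measurable_fun setT g.
  by apply: measurable_funB => //; apply: measurable_funM.
pose H : {measure set (measurableTypeR R) -> \bar R} :=
  measure_function_pushforward__canonical__measure_function_Measure lebesgue_measure mg.
move=> mS; have := @lebesgue_measure_unique R (mscale 2%:nng H).
move=> uniq; apply: (uniq _ _ S mS) => X [[a c] _ <-].
rewrite -[RHS]/(2%:E * lebesgue_measure (g @^-1` `]a, c]))%E.
rewrite (_ : g @^-1` _ = `](a + b%:R) / 2, (c + b%:R) / 2]%classic).
  rewrite !lebesgue_measure_itv/= !lte_fin ltr_pM2r ?invr_gt0// ltrD2r.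
  case: ifPn => _; last by rewrite mule0.
  by rewrite -!EFinB -EFinM; congr (_%:E); field.
apply/seteqP; split => t; rewrite /preimage/= /g !in_itv/= => /andP[? ?];
  apply/andP; split; lra.
Qed.

(** On points whose first digit is [b], the map [t -> 2 * t - b] deletes that digit. This recursion
    yields both the cylinder masses and the invariance of the product measure. *)
Lemma bernoulli_measure_cons (b : bool) (A : set symbolic_space) : measurable A ->
  (bernoulli_measure A = 2%:E * bernoulli_measure [set w | w 0%N = b /\ A (symbol_shift w)])%E.
Proof.
move=> mA.
have mdA : measurable (binary_digits @^-1` A).
  by rewrite -[X in measurable X]setTI; exact: measurable_binary_digits.
rewrite -[LHS]/(lebesgue_measure (binary_digits @^-1` A `&` unit_interval)).
rewrite (lebesgue_halving b); last first.
  by apply: measurableI => //; exact: measurable_unit_interval.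
congr (_ * lebesgue_measure _)%E.
rewrite -[X in _ = X]/(binary_digits @^-1`
  [set w | w 0%N = b /\ A (symbol_shift w)] `&` unit_interval).
have digit0 (t : R) : 0 <= t < 1 -> (binary_digits t 0 = b <-> 0 <= 2 * t - b%:R < 1).
  move=> /andP[t0 t1]; rewrite /binary_digits expr1.
  have [t2|t2] := ltP t 2^-1.
    have -> : Num.trunc (2 * t) = 0%N by apply: truncn_def; apply/andP; split; lra.
    case: b => /=; split => //.
      by move=> /andP[? ?]; exfalso; lra.
    by move=> _; apply/andP; split; lra.
  have -> : Num.trunc (2 * t) = 1%N by apply: truncn_def; apply/andP; split; lra.
  case: b => /=; split => //.
    by move=> _; apply/andP; split; lra.
  by move=> /andP[? ?]; exfalso; lra.
(* After scaling, the two numbers differ by [b * 2 ^ k.+1], an even integer, so the truncations have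
   the same parity. *)
have digitS (t : R) : 0 <= 2 * t - b%:R ->
    binary_digits (2 * t - b%:R) = symbol_shift (binary_digits t).
  move=> t0; apply/funext => k; rewrite /symbol_shift /binary_digits.
  have -> : 2 ^+ k.+2 * t = 2 ^+ k.+1 * (2 * t - b%:R) + (b * 2 ^ k.+1)%:R.
    by rewrite natrM natrX mulrBr exprSr; ring.
  have -> : Num.trunc (2 ^+ k.+1 * (2 * t - b%:R) + (b * 2 ^ k.+1)%:R) =
      (Num.trunc (2 ^+ k.+1 * (2 * t - b%:R)%R) + b * 2 ^ k.+1)%N.
    apply: truncn_def; rewrite -addSn !natrD lerD2r ltrD2r.
    by rewrite truncn_itv// mulr_ge0.
  by rewrite oddD oddM oddX andbF addbF.
apply/seteqP; split => t; rewrite /unit_interval /preimage/= !in_itv/=.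
  move=> [At tb]; have /andP[tb0 tb1] := tb.
  have t01 : 0 <= t < 1 by move: tb0 tb1; case: (b) => /= ? ?; apply/andP; split; lra.
  by rewrite -digitS// (digit0 t t01).
move=> [[/digit0 h At] t01]; have tb := h t01; have /andP[tb0 _] := tb.
by rewrite digitS.
Qed.

End BernoulliMeasure.

(** * The coding map and the limit set *)

Section CodingMap.
Context {R : realType}.
Variable lam : R.
Hypotheses (lam_half : 2^-1 < lam) (lam1 : lam < 1).
Let lam0 : 0 < lam := lt_trans (ltac:(by rewrite invr_gt0) : 0 < 2^-1) lam_half.
Let phi := S_ifs lam.
Let T := (symbolic_space * measurableTypeR R)%type.

Lemma phi_word_affine (s : seq bool) (x : R) :
  phi_word phi s x = lam ^+ size s * x + phi_word phi s 0.
Proof. by have := phi_word_rev lam (rev s) x; rewrite /word_val revK size_rev. Qed.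

Definition partial_coding (n : nat) (w : nat -> bool) : R :=
  phi_word phi (mkseq w n) 0.

(** The canonical projection to the limit set. Unlike in [word_val], the first symbol is applied
    last, which makes the sequence converge. *)
Definition coding_map (w : nat -> bool) : R := limn (fun n => partial_coding n w).

Lemma phi_word_mkseqS w n x :
  phi_word phi (mkseq w n.+1) x = phi (w 0%N) (phi_word phi (mkseq (symbol_shift w) n) x).
Proof.
rewrite /phi_word /mkseq /= -[1%N]addn0 iotaDl -map_comp.
by congr (phi _ (foldr _ _ _)); apply: eq_map.
Qed.

Lemma partial_codingS n w :
  partial_coding n.+1 w = partial_coding n w + lam ^+ n * (if w n then 1 else -1).
Proof.
rewrite /partial_coding mkseqS -cats1 {1}/phi_word foldr_cat.
rewrite -[LHS]/(phi_word phi (mkseq w n) (phi (w n) 0)) phi_word_affine addrC.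
by rewrite size_mkseq (_ : phi (w n) 0 = if w n then 1 else -1)// /phi /S_ifs mulr0 add0r.
Qed.

Lemma partial_coding_cvg w : partial_coding n w @[n --> \oo] --> coding_map w.
Proof.
have E : (fun n => partial_coding n w) =
    series (fun n => lam ^+ n * (if w n then 1 else -1)).
  apply/funext; elim=> [|n IH]; first by rewrite /series/= big_geq.
  by rewrite partial_codingS IH /series/= big_nat_recr.
suff : cvgn (fun n => partial_coding n w) by [].
rewrite E; apply: normed_cvg; apply: (@series_le_cvg _ _ (geometric 1 lam)) => //.
- by move=> n; exact: normr_ge0.
- by move=> n; rewrite /geometric/= mulr_ge0// exprn_ge0// ltW.
- move=> n; rewrite /geometric/= mul1r normrM ger0_norm ?exprn_ge0 ?(ltW lam0)//.
  by case: (w n); rewrite ?normrN normr1 mulr1.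
- by apply: is_cvg_geometric_series; rewrite gtr0_norm.
Qed.

Lemma coding_map_shift w : coding_map w = phi (w 0%N) (coding_map (symbol_shift w)).
Proof.
have h1 : partial_coding n.+1 w @[n --> \oo] --> coding_map w.
  by have := @partial_coding_cvg w; rewrite -(cvg_shiftn 1); under eq_fun do rewrite addn1.
have h2 : partial_coding n.+1 w @[n --> \oo] --> phi (w 0%N) (coding_map (symbol_shift w)).
  rewrite (_ : (fun n => partial_coding n.+1 w) =
    (fun n => lam * partial_coding n (symbol_shift w) + (if w 0%N then 1 else -1))).
    apply: cvgD; last exact: cvg_cst.
    by apply: cvgM; [exact: cvg_cst|exact: partial_coding_cvg].
  by apply/funext => n; rewrite /partial_coding phi_word_mkseqS.
exact: (cvg_unique _ h1 h2).
Qed.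

Lemma measurable_coding_map :
  measurable_fun setT (coding_map : symbolic_space -> measurableTypeR R).
Proof.
apply: (@measurable_fun_cvg _ symbolic_space R setT
  (partial_coding : nat -> symbolic_space -> R) coding_map); last first.
  by move=> w _; exact: partial_coding_cvg.
elim=> [|n IH]; first exact: measurable_cst.
rewrite (_ : partial_coding n.+1 =
  partial_coding n \+ (fun w => lam ^+ n * (if w n then 1 else -1))); last first.
  by apply/funext => w; rewrite partial_codingS.
apply: measurable_funD => //; apply: measurable_funM => //.
exact: (measurable_fun_label_if _ _ (measurable_coordinate n)).
Qed.

Definition attractor (K : set R) : Prop :=
  [/\ K !=set0, compact K & K = \bigcup_(i in [set: bool]) phi i @` K].

Let r : R := (1 - lam)^-1.

(** As [lam] exceeds one half, the two images of the interval cover it. This witness ensures that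
    [xget] in [limit_set] returns an invariant compact set. *)
Lemma attractor_itv : attractor `[- r, r].
Proof.
have l1 : 0 < 1 - lam by rewrite subr_gt0.
have rE : r = lam * r + 1 by rewrite /r; field; rewrite gt_eqF.
have lam_half' : 1 <= 2 * lam by rewrite -ler_pdivrMl// mulr1 ltW.
have r2 : 2 <= r by rewrite /r -(ler_pM2l l1) mulfV ?gt_eqF//; lra.
split; first by exists 0; rewrite /= in_itv/=; apply/andP; split; lra.
  exact: segment_compact.
apply/seteqP; split => x /=; rewrite !in_itv/=.
  move=> /andP[xr rx].
  exists (0 <= x) => //; exists ((x - (if 0 <= x then 1 else -1)) / lam); last first.
    by rewrite /phi /S_ifs; field; rewrite gt_eqF.
  rewrite /= in_itv/= ler_pdivrMr// ler_pdivlMr// [r * _]mulrC mulNr [r * _]mulrC.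
  by case: (leP 0 x) => x0; apply/andP; split; lra.
move=> [b _ [y]]; rewrite /= in_itv/= => /andP[ry yr] <-.
have : lam * y <= lam * r by rewrite ler_pM2l.
have : lam * - r <= lam * y by rewrite ler_pM2l.
by rewrite /phi /S_ifs; case: b => ? ?; apply/andP; split; lra.
Qed.

Lemma limit_set_attractor : attractor (limit_set phi).
Proof. exact: (xgetPex set0 (ex_intro attractor _ attractor_itv)). Qed.

(** Unfolding invariance [n] times bounds the set by [r + lam ^+ n * M'], where [M'] comes from
    compactness; then [n] goes to infinity. *)
Lemma limit_set_bound x : limit_set phi x -> `|x| <= r.
Proof.
have [_ cK KE] := limit_set_attractor.
have [M [_ hM]] := compact_bounded cK.
have l1 : 0 < 1 - lam by rewrite subr_gt0.
have rE : r = lam * r + 1 by rewrite /r; field; rewrite gt_eqF.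
have r0 : 0 < r by rewrite invr_gt0.
pose M' := `|M| + 1.
have M'0 : 0 < M' by rewrite ltr_pwDr.
have bound n y : limit_set phi y -> `|y| <= r + lam ^+ n * M'.
  elim: n y => [|n IH] y Ky.
    have MM' : M < M' by rewrite ltr_pwDr// ler_norm.
    by have := hM _ MM' y Ky; rewrite expr0 mul1r /=; lra.
  move: Ky; rewrite KE => -[b _ [z Kz <-]].
  rewrite /phi /S_ifs (le_trans (ler_normD _ _))//.
  have -> : `|if b then 1 else -1 : R| = 1 by case: b; rewrite ?normrN normr1.
  have := IH z Kz; rewrite -(ler_pM2l lam0) => h.
  by rewrite normrM gtr0_norm// exprS; lra.
move=> Kx; apply/ler_addgt0Pr => e e0.
have : lam ^+ n * M' @[n --> \oo] --> 0.
  rewrite -[X in _ --> X](mul0r M'); apply: cvgM; last exact: cvg_cst.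
  by apply: cvg_expr; rewrite gtr0_norm.
move=> /cvgrPdist_le/(_ e e0)[N _ /(_ N (leqnn N))].
rewrite sub0r normrN => h; apply: le_trans (bound N x Kx) _.
by rewrite lerD2l (le_trans (ler_norm _)).
Qed.

(** Images of a point of the limit set under longer and longer words stay in this closed set, and
    they converge to the coding map whatever the starting point. *)
Lemma coding_map_limit_set w : limit_set phi (coding_map w).
Proof.
have [[z Kz] cK KE] := limit_set_attractor.
have Kphi b y : limit_set phi y -> limit_set phi (phi b y).
  by move=> Ky; rewrite KE; exists b => //; exists y.
have h : phi_word phi (mkseq w n) z @[n --> \oo] --> coding_map w.
  rewrite -[X in _ --> X]add0r -[X in _ --> X + _](mul0r z).
  under eq_fun do rewrite phi_word_affine size_mkseq.
  apply: cvgD; last exact: partial_coding_cvg.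
  apply: cvgM; last exact: cvg_cst.
  by apply: cvg_expr; rewrite gtr0_norm.
apply: (closed_cvg _ _ _ _ h).
  by apply: compact_closed cK; exact: norm_hausdorff.
apply: nearW => n /=; elim: (mkseq w n) => [//|b s IH] /=.
exact: Kphi.
Qed.

End CodingMap.

Lemma measurable_cylinder (s : seq bool) :
  measurable ([set w | mkseq w (size s) = s] : set symbolic_space).
Proof.
pose X (w : symbolic_space) : {ffun 'I_(size s) -> bool} := [ffun k : 'I_(size s) => w k].
have mX : measurable_label X.
  apply: measurable_label_ffun => k.
  rewrite (_ : (fun w => _) = (fun w : symbolic_space => w k)).
    exact: measurable_coordinate.
  by apply/funext => w; rewrite ffunE.
have := measurable_label_preimage [set g : {ffun 'I_(size s) -> bool} |
   forall k, g k = nth false s k] mX.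
congr measurable; apply/seteqP; split => w.
  move=> h; apply: (@eq_from_nth _ false); rewrite size_mkseq// => i ilt.
  by rewrite nth_mkseq// -(h (Ordinal ilt)) ffunE.
by move=> h k; rewrite ffunE -[LHS](nth_mkseq false w (ltn_ord k)) h.
Qed.

Lemma bernoulli_measure_cylinder (R : realType) (s : seq bool) :
  @bernoulli_measure R [set w | mkseq w (size s) = s] = ((2 ^+ size s)^-1)%:E.
Proof.
elim: s => [|b s IH].
  rewrite /= expr0 invr1 (_ : [set w | _] = setT) ?probability_setT//.
  by apply/seteqP; split => w.
pose A : set symbolic_space := [set w | mkseq w (size s) = s].
have mA : measurable A by exact: measurable_cylinder.
have := @bernoulli_measure_cons R b A mA; rewrite IH.
rewrite (_ : [set w | w 0%N = b /\ _] =
  [set w | mkseq w (size (b :: s)) = b :: s]); last first.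
  have mkseqE w : mkseq w (size s).+1 = w 0%N :: mkseq (symbol_shift w) (size s).
    by rewrite /mkseq /= -[1%N]addn0 iotaDl -map_comp; congr cons; apply: eq_map.
  apply/seteqP; split => w; rewrite /A /= mkseqE; first by move=> [-> ->].
  by move=> [].
set B := bernoulli_measure _ => h.
have Bfin : B \is a fin_num.
  by rewrite fin_num_measure//; exact: (measurable_cylinder (b :: s)).
rewrite -(fineK Bfin) -EFinM in h; case: h => h.
rewrite -(fineK Bfin); congr (_%:E); rewrite exprS invfM h mulrA mulVf ?mul1r//.
Qed.

(** * An invariant measure on the lift with entropy at least [ln 2] *)

Section MaximalEntropy.
Context {R : realType}.
Variable lam : R.
Hypotheses (lam_half : 2^-1 < lam) (lam1 : lam < 1).
Let lam0 : 0 < lam := lt_trans (ltac:(by rewrite invr_gt0) : 0 < 2^-1) lam_half.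
Let T := (symbolic_space * measurableTypeR R)%type.
Let F : T -> T := lift_map (S_ifs lam).
Let mF : measurable_fun setT F := measurable_lift_map lam.

HB.instance Definition _ := @isMeasurableFun.Build _ _ symbolic_space (measurableTypeR R)
  (coding_map lam : symbolic_space -> measurableTypeR R) (measurable_coding_map lam_half lam1).

Let bern : probability symbolic_space R := bernoulli_measure.
(** The Bernoulli convolution: the law of the series of [lam ^+ n] with independent fair signs. *)
Let nu : probability (measurableTypeR R) R :=
  distribution bern (coding_map lam : symbolic_space -> measurableTypeR R).
Let mu0 : probability T R := (bern \x nu)%E.

Let mu0_rectangle (A : set symbolic_space) (C : set (measurableTypeR R)) :
  measurable A -> measurable C -> mu0 (A `*` C) = (bern A * nu C)%E.
Proof. exact: product_measure1E. Qed.

(** The preimage splits by first symbol into two rectangles: each first factor has half the mass of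
    [A], and the masses of the second factors add up to twice that of [C]. *)
Let map_rectangle (A : set symbolic_space) (C : set (measurableTypeR R)) :
  measurable A -> measurable C -> mu0 (F @^-1` (A `*` C)) = (bern A * nu C)%E.
Proof.
move=> mA mC.
pose Ab (b : bool) : set symbolic_space := [set w | w 0%N = b /\ A (symbol_shift w)].
pose Cb (b : bool) : set (measurableTypeR R) := [set x | C (S_ifs lam b x)].
have mshift : measurable_fun setT (symbol_shift : symbolic_space -> symbolic_space).
  by apply: measurable_to_symbolic => k; exact: measurable_coordinate.
have mAb b : measurable (Ab b).
  apply: measurableI; first exact: measurable_coordinate.
  by rewrite -[X in measurable X]setTI; exact: mshift.
have mCb b : measurable (Cb b).
  rewrite -[X in measurable X]setTI.
  have mS : measurable_fun setT (S_ifs lam b : measurableTypeR R -> measurableTypeR R).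
    by apply: measurable_funD => //; apply: measurable_funM.
  exact: mS.
have mcC : measurable (coding_map lam @^-1` C : set symbolic_space).
  by rewrite -[X in measurable X]setTI; exact: (measurable_coding_map lam_half lam1).
have FE : F @^-1` (A `*` C) = (Ab true `*` Cb true) `|` (Ab false `*` Cb false).
  apply/seteqP; split => -[w x]; rewrite /preimage /F /lift_map /Ab /Cb /=.
    by case E : (w 0%N) => -[Aw Cx]; [left|right].
  by case=> -[[/= w0 Aw] Cx]; split => //=; rewrite w0.
have cons b B : measurable B ->
    (bern B = 2%:E * bern [set w | w 0%N = b /\ B (symbol_shift w)])%E.
  exact: bernoulli_measure_cons.
have half b : (bern A = 2%:E * bern (Ab b))%E by exact: cons.
have fin d (U : measurableType d) (P : probability U R) B : measurable B ->
    exists2 x : R, P B = x%:E & True.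
  by move=> mB; exists (fine (P B)) => //; rewrite fineK// fin_num_measure.
(* Stationarity of [nu]: the coding of [w] is the map of its first symbol applied to the coding of
   the shifted sequence. *)
have nuE : (2%:E * nu C = nu (Cb true) + nu (Cb false))%E.
  have nuCb b : (nu (Cb b) =
      2%:E * bern [set w | w 0%N = b /\ C (coding_map lam w)])%E.
    rewrite -[LHS]/(bern (coding_map lam @^-1` (Cb b))) (cons b).
      congr (2%:E * bern _)%E; apply/seteqP; split => w [w0 h]; split=> //.
        by rewrite (coding_map_shift lam_half lam1) w0.
      by move: h; rewrite (coding_map_shift lam_half lam1) w0.
    rewrite -[X in measurable X]setTI.
    exact: (measurable_coding_map lam_half lam1).
  rewrite !nuCb -ge0_muleDr ?measure_ge0//; congr (_ * _)%E.
  rewrite -[LHS]/(bern (coding_map lam @^-1` C)) -measureU.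
  - congr (bern _); apply/seteqP; split => w; last by case=> -[].
    by rewrite /preimage/= => Cw; case E : (w 0%N); [left|right].
  - by apply: measurableI => //; exact: measurable_coordinate.
  - by apply: measurableI => //; exact: measurable_coordinate.
  - by apply/seteqP; split => // w [[w0 _] [w0' _]]; move: w0'; rewrite w0.
have -> : mu0 (F @^-1` (A `*` C)) =
    (mu0 (Ab true `*` Cb true) + mu0 (Ab false `*` Cb false))%E.
  rewrite FE; apply: measureU; [exact: measurableX|exact: measurableX|].
  by apply/seteqP; split => // -[w x] [[[/= w0 _] _] [[/= w0' _] _]]; move: w0'; rewrite w0.
rewrite !mu0_rectangle//.
have := half true; have := half false; move: nuE.
have [a -> _] := fin _ _ bern _ mA; have [a1 -> _] := fin _ _ bern _ (mAb true).
have [a2 -> _] := fin _ _ bern _ (mAb false); have [c -> _] := fin _ _ nu _ mC.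
have [c1 -> _] := fin _ _ nu _ (mCb true); have [c2 -> _] := fin _ _ nu _ (mCb false).
rewrite -!EFinM -!EFinD => -[h1] [h2] [h3]; congr (_%:E).
have -> : a1 = a / 2 by lra.
have -> : a2 = a / 2 by lra.
by rewrite -mulrDr -h1; field.
Qed.

Lemma product_bernoulli_invariant : invariant_probability mu0 F.
Proof.
move=> A mA.
pose H := measure_function_pushforward__canonical__measure_function_Measure mu0 mF.
apply/esym/(@product_measure_unique _ _ _ _ _ bern nu H map_rectangle).
exact: mA.
Qed.

Lemma max_entropy_reference : exists mu : probability T R,
  [/\ mu (lift_domain (S_ifs lam)) = 1%E, invariant_probability mu F &
      (ln 2)%:E <= metric_entropy mu F]%E.
Proof.
exists mu0; split; last 2 first.
- exact: product_bernoulli_invariant.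
- have mfs : measurable_label (first_symbol : T -> bool) := @measurable_lift_coordinate R 0.
  (* [metric_entropy] ranges over labels in an ordinal, so symbols are recoded injectively. *)
  pose code (b : bool) : 'I_2 := inord b.
  pose xi : T -> 'I_2 := code \o first_symbol.
  have mxi : measurable_label xi := measurable_label_comp code mfs.
  apply: (@le_trans _ _ (entropy_wrt mu0 F xi)%:E); last first.
    by apply: ereal_sup_ubound; exists 2, xi.
  rewrite lee_fin /entropy_wrt.
  have entropy_alpha n :
      partition_entropy mu0 (iterated_partition F first_symbol n) = n%:R * ln 2.
    rewrite /partition_entropy (eq_bigr (fun=> (2 ^+ n)^-1 * ln ((2 ^+ n)^-1))).
      rewrite sumr_const card_ffun card_bool card_ord -[_ *+ (2 ^ n)]mulr_natl natrX.
      by rewrite mulrA mulfV ?expf_neq0// mul1r lnV ?posrE ?exprn_gt0// opprK lnXn// mulr_natl.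
    move=> g _; rewrite (_ : mu0 _ = ((2 ^+ n)^-1)%:E)//.
    pose s := mkseq (fun k => if insub k is Some i then g i else false) n.
    have sizes : size s = n by rewrite size_mkseq.
    have -> : ((2 ^+ n)^-1)%:E = bernoulli_measure [set w | mkseq w (size s) = s] :> \bar R.
      by rewrite bernoulli_measure_cylinder sizes.
    have <- : mu0 ([set w | mkseq w (size s) = s] `*` setT) =
        bernoulli_measure [set w | mkseq w (size s) = s].
      by rewrite mu0_rectangle//; [rewrite probability_setT mule1|exact: measurable_cylinder].
    congr (mu0 _); rewrite sizes; apply/seteqP; split => p.
      move=> pg; split => //=; apply/eq_in_map => k; rewrite mem_iota add0n => kn.
      by rewrite insubT -pg ffunE /first_symbol iter_lift_fst addn0.
    move=> [/= /eq_in_map h _]; apply/ffunP => k; rewrite ffunE.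
    have := h k; rewrite mem_iota add0n ltn_ord /= => /(_ isT).
    by rewrite /first_symbol iter_lift_fst addn0 => ->; rewrite valK.
  have entropy_xi n : partition_entropy mu0 (iterated_partition F xi n) = n%:R * ln 2.
    have m1 := @measurable_iterated_partition _ _ _ first_symbol F n mF mfs.
    have m2 := @measurable_iterated_partition _ _ _ xi F n mF mxi.
    rewrite -entropy_alpha; apply/eqP; rewrite eq_le; apply/andP; split.
      apply: partition_entropy_le => // p q /iterated_partitionP h.
      by apply/iterated_partitionP => k kn; rewrite /xi /= h.
    apply: partition_entropy_le => // p q /iterated_partitionP h.
    have code_inj : injective code.
      by move=> [] [] // /(congr1 val); rewrite /= !inordK.
    by apply/iterated_partitionP => k /h /code_inj.
  have lim_ln2 : partition_entropy mu0 (iterated_partition F xi n) / n%:R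
      @[n --> \oo] --> (ln 2 : R).
    apply: (cvg_near_cst (ln 2)); near=> n.
    rewrite entropy_xi mulrAC mulfV ?mul1r// pnatr_eq0 -lt0n.
    by near: n; exists 1%N.
  by rewrite (cvg_lim _ lim_ln2).
rewrite (_ : lift_domain _ = setT `*` limit_set (S_ifs lam)); last first.
  by apply/seteqP; split => -[w x] //= [].
have [_ /compact_closed cK _] := limit_set_attractor lam_half lam1.
rewrite mu0_rectangle//; last first.
  by apply: closed_measurable; apply: cK; exact: norm_hausdorff.
rewrite probability_setT mul1e /nu /distribution/= /pushforward.
rewrite (_ : _ @^-1` _ = setT) ?probability_setT//.
by rewrite -subTset => w _; exact: coding_map_limit_set.
Unshelve. all: by end_near. Qed.
End MaximalEntropy.

(** * The overlap number *)

Section LabelIntegral.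
Context {R : realType} {d : measure_display} {T : measurableType d}.
Variable mu : probability T R.

Lemma measurable_fun_label (J : finType) (X : T -> J) d' (U : measurableType d')
    (h : J -> U) (D : set T) :
  measurable_label X -> measurable_fun D (h \o X).
Proof.
move=> mX mD B mB; apply: measurableI => //.
rewrite comp_preimage; exact: measurable_label_preimage.
Qed.

Lemma integral_label (J : finType) (X : T -> J) (h : J -> R) (D : set T) :
  measurable_label X -> measurable D -> mu D = 1%E -> (forall j, 0 <= h j) ->
  (\int[mu]_(p in D) (h (X p))%:E = (\sum_j h j * label_mass mu X j)%:E)%E.
Proof.
move=> mX mD D1 h0.
have muD A : measurable A -> (mu (A `&` D) = mu A)%E.
  move=> mA; apply/eqP; rewrite eq_le; apply/andP; split.
    by apply: le_measure; rewrite ?inE//; exact: measurableI.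
  have D0 : mu (~` D) = 0%E by rewrite probability_setC// D1 subee.
  apply: (@le_trans _ _ (mu ((A `&` D) `|` ~` D))).
    apply: le_measure; rewrite ?inE//.
      by apply: measurableU; [exact: measurableI|exact: measurableC].
    by move=> p Ap; have [Dp|Dp] := EM (D p); [left|right].
  rewrite -[leRHS]adde0 -D0; apply: measureU2; first exact: measurableI.
  exact: measurableC.
transitivity (\int[mu]_(p in D) (\sum_(j : J) (h j)%:E * (\1_(X @^-1` [set j]) p)%:E))%E.
  apply: eq_integral => p _; rewrite (bigD1 (X p))//= big1 ?adde0.
    by rewrite indicE mem_set// mule1.
  by move=> j jX; rewrite indicE memNset ?mule0//= => Xj; rewrite Xj eqxx in jX.
rewrite ge0_integral_sum//; last 2 first.
- move=> j; apply: measurable_funeM; apply/measurable_EFinP.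
  exact: measurable_indic.
- by move=> j p _; rewrite -EFinM lee_fin mulr_ge0.
rewrite -sumEFin; apply: eq_bigr => j _.
rewrite ge0_integralZl//; last 2 first.
- apply/measurable_EFinP; exact: measurable_indic.
- by rewrite lee_fin.
rewrite integral_indic// EFinM fine_probabilityK//; congr (_ * _)%E.
exact: muD.
Qed.

End LabelIntegral.

(** * Uniform words under maximal entropy, and bounds on the overlap integral *)

Section OverlapBounds.
Context {R : realType}.
Variable lam : R.
Hypotheses (lam_half : 2^-1 < lam) (lam1 : lam < 1).
Let lam0 : 0 < lam := lt_trans (ltac:(by rewrite invr_gt0) : 0 < 2^-1) lam_half.
Let T := (symbolic_space * measurableTypeR R)%type.
Let phi := S_ifs lam.
Let F : T -> T := lift_map phi.
Let mF : measurable_fun setT F := measurable_lift_map lam.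
Let mfs : measurable_label (first_symbol : T -> bool) := @measurable_lift_coordinate R 0.

Definition word_label (n : nat) (p : symbolic_space * measurableTypeR R) :
  n.-tuple bool := [tuple p.1 k | k < n].

Lemma word_labelE n p : word_label n p = mkseq p.1 n :> seq bool.
Proof.
apply: (@eq_from_nth _ false); first by rewrite size_tuple size_mkseq.
move=> k; rewrite size_tuple => kn; rewrite nth_mkseq//.
by rewrite -[k]/(val (Ordinal kn)) -tnth_nth tnth_mktuple.
Qed.

Lemma measurable_word_label n : measurable_label (word_label n : T -> _).
Proof.
rewrite (_ : word_label n = (fun g : {ffun 'I_n -> bool} => [tuple g k | k < n]) \o
  iterated_partition F first_symbol n).
  by apply: measurable_label_comp; exact: measurable_iterated_partition.
apply/funext => p; apply: eq_from_tnth => k.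
by rewrite !tnth_mktuple ffunE /first_symbol iter_lift_fst addn0.
Qed.

Lemma metric_entropy_lift_le_ln2 (mu : probability T R) :
  invariant_probability mu F -> (metric_entropy mu F <= (ln 2)%:E)%E.
Proof.
move=> muF; apply: (metric_entropy_lift_le lam0 muF (N := 1)) => //.
  by rewrite ln_ge0// ler1n.
rewrite mul1r; apply: le_trans (partition_entropy_le_card _ _) _.
  exact: measurable_iterated_partition.
by rewrite card_ffun card_bool card_ord expn1.
Qed.

(** The reference measure attains the bound [ln 2] common to all invariant measures, so a maximiser
    exists and [xget] does not return its default. *)
Lemma mu_maxP : max_entropy_measure F (lift_domain phi) (mu_max phi).
Proof.
have [mu [muD muF mu_ln2]] := max_entropy_reference lam_half lam1.
apply: (@xgetPex _ point [set mu | max_entropy_measure F (lift_domain phi) mu]).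
exists mu; split => // nu _ nuF; apply: le_trans mu_ln2.
exact: metric_entropy_lift_le_ln2.
Qed.

(** If words of length [n] had entropy below [n%:R * ln 2], the block bound at that length would
    push the metric entropy below [ln 2]. Full word entropy forces the uniform law. *)
Lemma max_entropy_uniform (mu : probability T R) n (t : n.-tuple bool) :
  max_entropy_measure F (lift_domain phi) mu ->
  label_mass mu (word_label n) t = (2 ^+ n)^-1.
Proof.
move=> [muD muF mu_max].
have [mu0 [mu0D mu0F mu0_ln2]] := max_entropy_reference lam_half lam1.
have mu_ln2 : ((ln 2)%:E <= metric_entropy mu F)%E.
  by apply: le_trans mu0_ln2 _; exact: mu_max.
rewrite -card_words; apply: partition_entropy_card_uniform.
  exact: measurable_word_label.
pose H := partition_entropy mu (iterated_partition F first_symbol n).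
have HE : H <= partition_entropy mu (word_label n).
  apply: partition_entropy_le; first exact: measurable_word_label.
  move=> p q /(congr1 val)/=; rewrite !word_labelE => /eq_in_map h.
  apply/first_symbols_eqP => k kn; apply: h.
  by rewrite mem_iota.
apply: le_trans HE; rewrite card_words lnXn// -[_ *+ n]mulr_natl.
case: n t @H => [|n] t H.
  rewrite mul0r; apply: partition_entropy_ge0.
  exact: measurable_iterated_partition.
rewrite leNgt; apply/negP => Hlt.
have n0 : 0 < n.+1%:R :> R by rewrite ltr0n.
(* The maximum supplies the nonnegativity that the block bound requires; [c] stays below [ln 2],
   which is positive. *)
pose c := Num.max 0 (n.+1%:R^-1 * H).
have : (metric_entropy mu F <= c%:E)%E.
  apply: (metric_entropy_lift_le lam0 muF (N := n.+1)) => //.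
    by rewrite le_max lexx.
  by rewrite -ler_pdivrMl// le_max lexx orbT.
apply/negP; rewrite -ltNge; apply: lt_le_trans mu_ln2.
rewrite lte_fin gt_max ln_gt0 ?ltr1n//=.
by rewrite ltr_pdivrMl.
Qed.

(** Words with equal values define the same map, so [y] can be [p.2] itself. Conversely, a common
    image makes the values differ by [lam ^+ n * (p.2 - y)], with both points in the limit set. *)
Lemma overlap_count_bounds n (p : T) : lift_domain phi p ->
  (multiplicity (fun v : n.-tuple bool => word_val lam v) (word_label n p) <=
   overlap_count phi n p.1 p.2 <=
   near_count (fun v : n.-tuple bool => word_val lam v)
     (2 * lam ^+ n / (1 - lam)) (word_label n p))%N.
Proof.
move=> Kp; apply/andP; split; apply: subset_leq_card; apply/fintype.subsetP => eta.
  rewrite !inE => /eqP e; exists p.2 => //.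
  by rewrite !phi_word_rev size_mkseq size_tuple e word_labelE.
rewrite !inE => -[y Ky]; rewrite !phi_word_rev size_mkseq size_tuple word_labelE => e.
have -> : word_val lam eta - word_val lam (mkseq p.1 n) = lam ^+ n * (p.2 - y) by lra.
have ln0 : 0 < lam ^+ n by rewrite exprn_gt0.
rewrite normrM (gtr0_norm ln0) [2 * _]mulrC -mulrA ler_pM2l//.
rewrite (le_trans (ler_normB _ _))//.
have := limit_set_bound lam_half lam1 Kp; have := limit_set_bound lam_half lam1 Ky.
by move=> ? ?; lra.
Qed.

Lemma measurable_limit_set : measurable (limit_set phi : set (measurableTypeR R)).
Proof.
have [_ /compact_closed cK _] := limit_set_attractor lam_half lam1.
by apply: closed_measurable; apply: cK; exact: norm_hausdorff.
Qed.

Lemma measurable_lift_domain : measurable (lift_domain phi : set T).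
Proof.
have mK := measurable_limit_set.
rewrite (_ : lift_domain _ = setT `*` limit_set phi); first exact: measurableX.
by apply/seteqP; split => -[w x] //= [].
Qed.

Lemma measurable_word_val n :
  measurable_fun setT (fun p : T => word_val lam (mkseq p.1 n) : measurableTypeR R).
Proof.
elim: n => [|n IH]; first exact: measurable_cst.
rewrite (_ : (fun p => _) = (fun p : T => lam * word_val lam (mkseq p.1 n)) \+
  (fun p : T => if p.1 n then 1 else -1)); last first.
  by apply/funext => p; rewrite mkseqS word_val_rcons.
apply: measurable_funD; first exact: measurable_funM.
exact: measurable_fun_label_if (measurable_lift_coordinate n).
Qed.

Lemma measurable_overlap_count n :
  exists2 X : T -> 'I_(#|{: n.-tuple bool}|.+1), measurable_label X &
    forall p, X p = overlap_count phi n p.1 p.2 :> nat.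
Proof.
have ln0 : lam ^+ n != 0 by rewrite expf_neq0// gt_eqF.
(* The only candidate for [y]: the map of [eta] is inverted at the image of [p.2] under the first
   [n] symbols. *)
pose hit (eta : n.-tuple bool) (p : T) : R :=
  p.2 + (lam ^+ n)^-1 * (word_val lam (mkseq p.1 n) - word_val lam eta).
have mhit eta : measurable_fun setT (hit eta : T -> measurableTypeR R).
  apply: measurable_funD; first exact: measurable_snd.
  apply: measurable_funM => //; apply: measurable_funB => //.
  exact: measurable_word_val.
have hitP (eta : n.-tuple bool) (p : T) : (exists2 y, limit_set phi y &
    phi_word phi (rev (mkseq p.1 n)) p.2 = phi_word phi (rev eta) y) <->
    limit_set phi (hit eta p).
  rewrite phi_word_rev size_mkseq; split=> [[y Ky]|Kh].
    rewrite phi_word_rev size_tuple => e; rewrite (_ : hit eta p = y)//.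
    apply: (mulfI ln0); rewrite mulrDr mulVKf//; lra.
  exists (hit eta p) => //.
  by rewrite phi_word_rev size_tuple mulrDr mulVKf//; lra.
have mK := measurable_limit_set.
pose bits (p : T) : {ffun n.-tuple bool -> bool} :=
  [ffun eta => `[< limit_set phi (hit eta p) >]].
pose count (b : {ffun n.-tuple bool -> bool}) : 'I_(#|{: n.-tuple bool}|.+1) :=
  inord #|[pred eta | b eta]|.
exists (count \o bits).
  apply: (measurable_label_comp count); apply: measurable_label_ffun => eta.
  rewrite (_ : (fun p => _) =
    (fun x : measurableTypeR R => `[< limit_set phi x >]) \o hit eta); last first.
    by apply/funext => p; rewrite ffunE.
  apply: measurable_label_map => // -[].
    rewrite (_ : _ @^-1` _ = limit_set phi)//.
    by apply/seteqP; split => x /asboolP.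
  rewrite (_ : _ @^-1` _ = ~` limit_set phi); first exact: measurableC.
  apply/seteqP; split => [x|x nKx]; last by rewrite /preimage/= asboolF.
  by rewrite /preimage/= => Kx Kx'; rewrite asboolT in Kx.
move=> p; rewrite /count /= inordK ?ltnS ?max_card//.
apply: eq_card => eta; rewrite !inE ffunE.
by apply/asboolP/asboolP => /hitP.
Qed.

(** The two bounds on the overlap count depend only on the first [n] symbols, which are uniform
    under [mu_max], so their logarithms integrate to word averages. *)
Lemma integral_overlap_bounds n :
  avg_ln_multiplicity lam n <=
    \int[mu_max phi]_(p in lift_domain phi) ln (overlap_count phi n p.1 p.2)%:R <=
    avg_ln_near_count lam n.
Proof.
have mumax := mu_maxP; have [muD _ _] := mumax.
have mD := measurable_lift_domain.
have int_avg (h : n.-tuple bool -> R) : (forall w, 0 <= h w) ->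
    (\int[mu_max phi]_(p in lift_domain phi) (h (word_label n p))%:E =
     (word_average h)%:E)%E.
  move=> h0; rewrite integral_label//; last exact: measurable_word_label.
  congr (_%:E); rewrite /word_average mulr_sumr; apply: eq_bigr => t _.
  by rewrite max_entropy_uniform// mulrC.
have [X mX XE] := measurable_overlap_count n.
have avg_le (f g : T -> R) : measurable_fun setT f -> measurable_fun setT g ->
    (forall p, lift_domain phi p -> 0 <= f p <= g p) ->
    (\int[mu_max phi]_(p in lift_domain phi) (f p)%:E <=
     \int[mu_max phi]_(p in lift_domain phi) (g p)%:E)%E.
  move=> mf mg fg; apply: ge0_le_integral => //.
  - by move=> p /fg /andP[f0 _]; rewrite lee_fin.
  - by apply/measurable_EFinP; exact: measurable_funS mf.
  - by apply/measurable_EFinP; exact: measurable_funS mg.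
  - by move=> p /fg /andP[_ ?]; rewrite lee_fin.
pose m (w : n.-tuple bool) : R :=
  ln (multiplicity (fun v : n.-tuple bool => word_val lam v) w)%:R.
pose M (w : n.-tuple bool) : R := ln (near_count (fun v : n.-tuple bool =>
  word_val lam v) (2 * lam ^+ n / (1 - lam)) w)%:R.
have ln_nat_ge0 (k : nat) : 0 <= ln k%:R :> R.
  by case: k => [|k]; [rewrite ln0|rewrite ln_ge0// ler1n].
have mh (J : finType) (Y : T -> J) (h : J -> R) : measurable_label Y ->
    measurable_fun setT (h \o Y) by exact: measurable_fun_label.
have mw := @measurable_word_label n.
have lnXE : (fun p : T => ln (overlap_count phi n p.1 p.2)%:R) =
    (fun k : 'I_(#|{: n.-tuple bool}|.+1) => ln k%:R : R) \o X.
  by apply/funext => p; rewrite /= XE.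
have ln_mono (a b : nat) : (0 < a)%N -> (a <= b)%N -> ln a%:R <= ln b%:R :> R.
  by move=> a0 ab; rewrite ler_ln ?posrE ?ltr0n ?ler_nat// (leq_trans a0).
have mln : measurable_fun setT (fun p : T => ln (overlap_count phi n p.1 p.2)%:R : R).
  by rewrite lnXE; exact: mh.
have lower := avg_le _ _ (mh _ _ m mw) mln.
have upper := avg_le _ _ mln (mh _ _ M mw).
rewrite /comp in lower upper.
rewrite int_avg in lower; last by move=> w; exact: ln_nat_ge0.
rewrite int_avg in upper; last by move=> w; exact: ln_nat_ge0.
have {}lower : ((avg_ln_multiplicity lam n)%:E <=
    \int[mu_max phi]_(p in lift_domain phi) (ln (overlap_count phi n p.1 p.2)%:R)%:E)%E.
  apply: lower => p /(overlap_count_bounds n)/andP[h _].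
  by rewrite ln_nat_ge0 ln_mono// multiplicity_gt0.
have {}upper : (\int[mu_max phi]_(p in lift_domain phi)
    (ln (overlap_count phi n p.1 p.2)%:R)%:E <= (avg_ln_near_count lam n)%:E)%E.
  apply: upper => p /(overlap_count_bounds n)/andP[h h'].
  rewrite ln_nat_ge0 ln_mono// (leq_trans _ h)//.
  exact: multiplicity_gt0.
(* [Rintegral] is [fine] of the extended integral, which the two real bounds show to be finite. *)
rewrite /Rintegral; set I := (\int[_]_(_ in _) _)%E in lower upper *.
have Ifin : I \is a fin_num.
  by clearbody I; case: I lower upper.
by rewrite -(lee_fin (avg_ln_multiplicity _ _)) -(lee_fin (fine I)) fineK// lower.
Qed.

End OverlapBounds.

Unset Implicit Arguments.

Theorem theorem2 (R : realType) (lambda : R)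
    (lambda_half : 2^-1 < lambda) (lambda_lt1 : lambda < 1)
    (pisot_lambdaV : pisot_number lambda^-1) :
  2 * lambda <= topological_overlap_number (S_ifs lambda) /\ 1 < 2 * lambda.
Proof.
have lambda0 : 0 < lambda by apply: lt_trans lambda_half; rewrite invr_gt0.
split; last by rewrite -ltr_pdivrMl// mulr1.
have [l l_ge h] := overlap_limit lambda0 lambda_lt1 pisot_lambdaV.
have l_lim := h _ (integral_overlap_bounds lambda_half lambda_lt1).
rewrite /topological_overlap_number /overlap_number (cvg_lim _ l_lim)//.
by rewrite -ler_expR lnK ?posrE ?mulr_gt0// in l_ge.
Qed.
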